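(* Let $n\ge1$. The total number $a_n=a_n^0+a_n^1$ of involutions $z\in\mathcal I(W_n)$ with $|\mathcal A(z)|=1$ (where $a_n^i$ is the number of such $z$ with exactly $i$ negated points, $i\in\{0,1\}$) is $$a_n=(n+3)2^{n-2}\ \text{ if } n \text{ is odd},\qquad a_n=(n+4)2^{n-2}-\frac n4\binom{n}{n/2}\ \text{ if } n\text{ is even}.$$
   Context: $[\pm n]=\{\pm1,\dots,\pm n\}$. $W_n$ is the group of bijections $w:[\pm n]\to[\pm n]$ with $w(-i)=-w(i)$, a Coxeter group with simple generators $t_0=(-1,1)$ and $t_i=(-i,-i-1)(i,i+1)$ for $1\le i\le n-1$, and length function $\ell$. The Demazure product $\circ$ is the unique associative product on $W_n$ with $s\circ s=s$ for simple generators $s$ and $u\circ v=uv$ whenever $\ell(uv)=\ell(u)+\ell(v)$. $\mathcal I(W_n)=\{w\in W_n:w=w^{-1}\}$ (including the identity). For $z\in\mathcal I(W_n)$, $\mathcal A(z)$ is the set of minimal-length elements of $\{w\in W_n:w^{-1}\circ w=z\}$. A negated point of $z$ is an $i\in\{1,\dots,n\}$ with $z(i)=-i$. (An involution with $|\mathcal A(z)|=1$ has at most one negated point.) *)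

(* Defs.v *)
From HB Require Import structures.
From mathcomp Require Import all_boot all_order all_algebra all_fingroup.
From mathcomp Require Import zify.

Set Implicit Arguments.
Unset Strict Implicit.
Unset Printing Implicit Defensive.

Import GroupScope.

(* The set {±1, ..., ±n}: (false, i) stands for i + 1 and (true, i) for
   -(i + 1), as recorded by pt_int; pos i and neg_pt (pos i) are the two
   points of absolute value i + 1. *)
Definition pt (n : nat) : finType := (bool * 'I_n)%type.

Definition pos n (i : 'I_n) : pt n := (false, i).

Definition neg_pt n (x : pt n) : pt n := (~~ x.1, x.2).

Definition pt_int n (x : pt n) : int :=
  if x.1 then (- (x.2.+1)%:Z)%R else (x.2.+1)%:Z%R.

Definition is_signed n (w : {perm pt n}) : bool :=
  [forall x, w (neg_pt x) == neg_pt (w x)].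

Record signed_perm (n : nat) := SignedPerm {
  sp_perm :> {perm pt n};
  sp_permP : is_signed sp_perm }.

HB.instance Definition _ n := [isSub for @sp_perm n].
HB.instance Definition _ n := [Finite of signed_perm n by <:].

Section Group.
Variable n : nat.
Implicit Types u v w : signed_perm n.

Lemma sp_neg w x : w (neg_pt x) = neg_pt (w x).
Proof. by case: w => w /= /forallP/(_ x)/eqP. Qed.

Lemma sp_one_subproof : is_signed (1 : {perm pt n}).
Proof. by apply/forallP=> x; rewrite !perm1. Qed.

Lemma sp_mul_subproof u v : is_signed (sp_perm v * sp_perm u).
Proof. by apply/forallP=> x; rewrite !permM !sp_neg. Qed.

Lemma sp_inv_subproof u : is_signed (sp_perm u)^-1.
Proof.
by apply/forallP=> x; apply/eqP/(@perm_inj _ u); rewrite sp_neg !permKV.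
Qed.

(* MathComp composes permutations from left to right, whence the swap: here
   (u * v) x = u (v x), see spM. *)
Definition sp_one := SignedPerm sp_one_subproof.
Definition sp_mul u v := SignedPerm (sp_mul_subproof u v).
Definition sp_inv u := SignedPerm (sp_inv_subproof u).

Lemma sp_mulA : associative sp_mul.
Proof. by move=> u v w; apply: val_inj; rewrite /= mulgA. Qed.

Lemma sp_mul1 : left_id sp_one sp_mul.
Proof. by move=> u; apply: val_inj; rewrite /= mulg1. Qed.

Lemma sp_mulV : left_inverse sp_one sp_inv sp_mul.
Proof. by move=> u; apply: val_inj; rewrite /= mulgV. Qed.

End Group.

HB.instance Definition _ n :=
  Finite_isGroup.Build (signed_perm n) (@sp_mulA n) (@sp_mul1 n) (@sp_mulV n).

Lemma sp1 n x : (1 : signed_perm n) x = x.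
Proof. by rewrite perm1. Qed.

Lemma spM n (u v : signed_perm n) x : (u * v) x = u (v x).
Proof. by rewrite permM. Qed.

Lemma spP n (u v : signed_perm n) : (forall x, u x = v x) -> u = v.
Proof. by move=> uv; apply/val_inj/permP. Qed.

Section Generators.
Variable n : nat.
Implicit Types (u v w : signed_perm n) (i j : 'I_n) (x y : pt n).

(* (lo i, hi i) is (-1, 1) for i = 0 and (i, i + 1) for 0 < i. *)
Definition lo i : pt n :=
  if i == 0 :> nat then neg_pt (pos i) else pos (ord_pred i).
Definition hi i : pt n := pos i.

Definition gen_perm i : {perm pt n} :=
  if i == 0 :> nat then tperm (lo i) (hi i)
  else tperm (neg_pt (lo i)) (neg_pt (hi i)) * tperm (lo i) (hi i).

Lemma neg_ptK : involutive (@neg_pt n).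
Proof. by case=> b i; rewrite /neg_pt /= negbK. Qed.

Lemma neg_pt_neq x : neg_pt x <> x.
Proof. by case: x => -[] i []. Qed.

Lemma pt_int_inj : injective (@pt_int n).
Proof.
move=> [b i] [c j]; rewrite /pt_int /=.
by case: b; case: c => //= E; congr (_, _); apply: val_inj; move: E => /=; lia.
Qed.

Lemma pt_int_neg x : pt_int (neg_pt x) = (- pt_int x)%R.
Proof. by case: x => [[] i]; rewrite /pt_int //= GRing.opprK. Qed.

Lemma pt_int_neq0 x : pt_int x <> 0%R.
Proof. by case: x => [[] i]; rewrite /pt_int /=; lia. Qed.

Lemma pt_int_hi i : pt_int (hi i) = (i.+1)%:Z%R.
Proof. by []. Qed.

Lemma pt_int_lo i :
  pt_int (lo i) = if i == 0 :> nat then (-1)%R else (i : nat)%:Z%R.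
Proof.
rewrite /lo; case: (altP (i =P 0 :> nat)) => i0; rewrite /pt_int /=; first by lia.
have := ltn_ord i => lt_in.
have -> : (i + n).-1 %% n = i.-1.
  by rewrite (_ : (i + n).-1 = (i.-1 + n))%N ?modnDr ?modn_small //; lia.
by lia.
Qed.

Lemma eq_pt_int x y : (x == y) = (pt_int x == pt_int y).
Proof. by rewrite (inj_eq pt_int_inj). Qed.

Lemma gen_permE i x : gen_perm i x =
  if x == lo i then hi i else if x == hi i then lo i else
  if x == neg_pt (lo i) then neg_pt (hi i) else
  if x == neg_pt (hi i) then neg_pt (lo i) else x.
Proof.
rewrite /gen_perm; case: ifP => i0.
  have L : lo i = neg_pt (hi i) by rewrite /lo i0.
  rewrite L neg_ptK permE /=.
  by do 2?case: eqP => // _; rewrite -?L.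
rewrite permM !permE /=.
have := pt_int_lo i; have := pt_int_hi i; rewrite i0 => Eh El.
rewrite !eq_pt_int !pt_int_neg.
by do ![case: eqP; rewrite ?pt_int_neg] => //=; lia.
Qed.

Lemma lo_hi_int i : let l := pt_int (lo i) in let h := pt_int (hi i) in
  (l = -1 /\ h = 1)%R \/ (0 < l /\ h = l + 1)%R.
Proof.
by rewrite /= pt_int_lo pt_int_hi; case: eqP => i0; [left|right]; lia.
Qed.

Lemma gen_perm_int i x :
  let l := pt_int (lo i) in let h := pt_int (hi i) in
  let p := pt_int x in let q := pt_int (gen_perm i x) in
  [\/ p = l /\ q = h, p = h /\ q = l |
   [\/ p = (- l)%R /\ q = (- h)%R, p = (- h)%R /\ q = (- l)%R |
    [/\ p <> l, p <> h, p <> (- l)%R, p <> (- h)%R & q = p]]].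
Proof.
have E y : x <> y -> pt_int x <> pt_int y by move=> xy /pt_int_inj.
rewrite /= gen_permE -!pt_int_neg.
case: eqP => [->|/E ?]; first by constructor 1.
case: eqP => [->|/E ?]; first by constructor 2.
case: eqP => [->|/E ?]; first by constructor 3; constructor 1.
case: eqP => [->|/E ?]; first by constructor 3; constructor 2.
by constructor 3; constructor 3.
Qed.

Lemma gen_subproof i : is_signed (gen_perm i).
Proof.
apply/forallP=> x; apply/eqP/pt_int_inj; rewrite pt_int_neg.
have := gen_perm_int i x; have := gen_perm_int i (neg_pt x).
have := lo_hi_int i; rewrite /= pt_int_neg.
move: (pt_int (lo i)) (pt_int (hi i)) (pt_int x) => l h p.
move: (pt_int (gen_perm i x)) (pt_int (gen_perm i (neg_pt x))) => q q' {x}.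
by case=> -[? ?]; case=> [[? ?]|[? ?]|[[? ?]|[? ?]|[? ? ? ? ?]]];
  case=> [[? ?]|[? ?]|[[? ?]|[? ?]|[? ? ? ? ?]]]; lia.
Qed.

Definition gen i : signed_perm n := SignedPerm (gen_subproof i).

Lemma genE i x : gen i x =
  if x == lo i then hi i else if x == hi i then lo i else
  if x == neg_pt (lo i) then neg_pt (hi i) else
  if x == neg_pt (hi i) then neg_pt (lo i) else x.
Proof. exact: gen_permE. Qed.

Lemma gen_lo i : gen i (lo i) = hi i.
Proof. by rewrite genE eqxx. Qed.

Lemma gen_hi i : gen i (hi i) = lo i.
Proof. by rewrite genE eqxx; case: eqP => // ->. Qed.

Lemma gen_int i x :
  let l := pt_int (lo i) in let h := pt_int (hi i) in
  let p := pt_int x in let q := pt_int (gen i x) in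
  [\/ p = l /\ q = h, p = h /\ q = l |
   [\/ p = (- l)%R /\ q = (- h)%R, p = (- h)%R /\ q = (- l)%R |
    [/\ p <> l, p <> h, p <> (- l)%R, p <> (- h)%R & q = p]]].
Proof. exact: gen_perm_int. Qed.

Lemma genK i x : gen i (gen i x) = x.
Proof.
apply: pt_int_inj; have := gen_int i x; have := gen_int i (gen i x).
have := lo_hi_int i; rewrite /=.
move: (pt_int (lo i)) (pt_int (hi i)) (pt_int x) => l h p.
move: (pt_int (gen i x)) (pt_int (gen i (gen i x))) => q q' {x}.
by case=> -[? ?]; case=> [[? ?]|[? ?]|[[? ?]|[? ?]|[? ? ? ? ?]]];
  case=> [[? ?]|[? ?]|[[? ?]|[? ?]|[? ? ? ? ?]]]; lia.
Qed.

Lemma gen_sqr i : gen i * gen i = 1.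
Proof. by apply: spP => x; rewrite spM genK sp1. Qed.

Lemma genV i : (gen i)^-1 = gen i.
Proof. by apply/(mulgI (gen i)); rewrite mulgV gen_sqr. Qed.

(* i is an ascent of w: by ascE below, w * gen i is longer than w. *)
Definition asc w i := (pt_int (w (lo i)) < pt_int (w (hi i)))%R.

Lemma lo_neq_hi w i : pt_int (w (lo i)) <> pt_int (w (hi i)).
Proof.
move/pt_int_inj/perm_inj/(congr1 (@pt_int n)); rewrite pt_int_lo pt_int_hi.
by case: ifP; lia.
Qed.

Lemma asc_mul_gen w i : asc (w * gen i) i = ~~ asc w i.
Proof.
by rewrite /asc !spM gen_lo gen_hi; have := @lo_neq_hi w i; lia.
Qed.

Lemma gen_inversion j x y : (pt_int x < pt_int y)%R ->
    (pt_int (gen j y) < pt_int (gen j x))%R ->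
  (x = lo j /\ y = hi j) \/ (x = neg_pt (hi j) /\ y = neg_pt (lo j)).
Proof.
move=> xy gxy.
suff: (pt_int x = pt_int (lo j) /\ pt_int y = pt_int (hi j)) \/
  (pt_int x = pt_int (neg_pt (hi j)) /\ pt_int y = pt_int (neg_pt (lo j))).
  by case=> -[/pt_int_inj-> /pt_int_inj->]; [left|right].
move: xy gxy (@pt_int_neq0 x) (@pt_int_neq0 y).
have := gen_int j x; have := gen_int j y.
have := lo_hi_int j; rewrite /= !pt_int_neg.
move: (pt_int (lo j)) (pt_int (hi j)) (pt_int x) (pt_int y) => l h p r.
move: (pt_int (gen j x)) (pt_int (gen j y)) => q q' {x y}.
by case=> -[? ?]; case=> [[? ?]|[? ?]|[[? ?]|[? ?]|[? ? ? ? ?]]];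
  case=> [[? ?]|[? ?]|[[? ?]|[? ?]|[? ? ? ? ?]]]; lia.
Qed.

Lemma gen_conj w i j :
    (w (lo i) = lo j /\ w (hi i) = hi j) \/
    (w (lo i) = neg_pt (hi j) /\ w (hi i) = neg_pt (lo j)) ->
  gen j * w = w * gen i.
Proof.
move=> wij; apply: spP => x; rewrite !spM !genE.
have {wij}[[<- <-]|[El Eh]] : (w (lo i) = lo j /\ w (hi i) = hi j) \/
    (lo j = w (neg_pt (hi i)) /\ hi j = w (neg_pt (lo i))).
- by case: wij => -[El Eh]; [left|right]; rewrite // !sp_neg El Eh !neg_ptK.
- move: (lo i) (hi i) => l h; rewrite -!sp_neg !(inj_eq (@perm_inj _ w)).
  by rewrite !(fun_if w).
rewrite El Eh; move: (lo i) (hi i) => l h {El Eh}.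
rewrite -!sp_neg !(inj_eq (@perm_inj _ w)) !neg_ptK -!(fun_if w).
congr (w _); have := neg_ptK l; have := neg_ptK h.
have := @neg_pt_neq l; have := @neg_pt_neq h.
by do 4?[case: eqP => ? //=]; congruence.
Qed.

Lemma asc_gen_mul w i j :
  asc (gen j * w) i = asc w i \/ gen j * w = w * gen i.
Proof.
have lohi := @lo_neq_hi w i; have glohi := @lo_neq_hi (gen j * w) i.
case E1 : (asc w i); case E2: (asc (gen j * w) i); try by left.
all: right; move: lohi glohi E1 E2; rewrite /asc !spM => lohi glohi E1 E2.
- by apply/gen_conj/gen_inversion; lia.
have: gen j * (w * gen i) = w * gen i * gen i.
  apply: gen_conj; rewrite !spM gen_lo gen_hi; apply: gen_inversion; lia.
by rewrite mulgA => /mulIg.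
Qed.

(* word [:: i1; ...; ik] = t_i1 * ... * t_ik *)
Definition word (s : seq 'I_n) : signed_perm n := \prod_(i <- s) gen i.

Lemma word_cons i s : word (i :: s) = gen i * word s.
Proof. by rewrite /word big_cons. Qed.

Lemma word_rcons s i : word (rcons s i) = word s * gen i.
Proof. by rewrite /word -cats1 big_cat big_seq1. Qed.

Lemma word_cat s1 s2 : word (s1 ++ s2) = word s1 * word s2.
Proof. by rewrite /word big_cat. Qed.

Lemma incr_fix (f : 'I_n -> 'I_n) :
  (forall i j, i < j -> f i < f j) -> forall i, f i = i.
Proof.
move=> fI; have ge_f (m : nat) (i : 'I_n) : i = m :> nat -> i <= f i.
  elim: m i => [|m IH] i im; first by rewrite im.
  have mn : m < n by rewrite (leq_trans _ (ltn_ord i)) // im.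
  have := IH (Ordinal mn) erefl; have := fI (Ordinal mn) i; rewrite /=; lia.
have le_f (m : nat) (i : 'I_n) : n = i + m.+1 :> nat -> f i <= i.
  elim: m i => [|m IH] i im; first by have := ltn_ord (f i); lia.
  have mn : i.+1 < n by lia.
  have := IH (Ordinal mn); have := fI i (Ordinal mn); rewrite /=; lia.
move=> i; apply: val_inj; apply/eqP; rewrite eqn_leq.
by rewrite (le_f (n - i.+1)) ?(ge_f i) //; have := ltn_ord i; lia.
Qed.

Lemma all_asc w : (forall i, asc w i) -> w = 1.
Proof.
move=> wa.
have step (m : nat) (i : 'I_n) : i = m :> nat ->
    (w (hi i)).1 = false /\
    (forall j : 'I_n, j < i -> (w (hi j)).2 < (w (hi i)).2).
  elim: m i => [|m IH] i im.
    split=> [|j]; last by rewrite im.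
    move: (wa i); rewrite /asc /lo im /= sp_neg -/(hi i) pt_int_neg.
    by rewrite /pt_int; case: (w (hi i)) => -[] //= k; lia.
  have mn : m < n by have := ltn_ord i; lia.
  have E : lo i = hi (Ordinal mn).
    by apply: pt_int_inj; rewrite pt_int_lo pt_int_hi /= im.
  have [p1 p2] := IH (Ordinal mn) erefl.
  move: (wa i); rewrite /asc E /pt_int p1 /=; case: ifP => [_|_ lt]; first by lia.
  split=> // j ji.
  case: (ltngtP j m) => jm; first exact: ltn_trans (p2 j jm) lt.
    by move: ji; rewrite im; lia.
  by rewrite (_ : j = Ordinal mn) //; apply: val_inj.
have fix2 := @incr_fix (fun i => (w (hi i)).2) (fun i j => (step j j erefl).2 i).
have fixh i : w (hi i) = hi i.
  by rewrite [LHS]surjective_pairing fix2 (step i i erefl).1.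
apply: spP => -[[] i]; rewrite sp1; last exact: fixh.
by rewrite -[(true, i)]/(neg_pt (hi i)) sp_neg fixh.
Qed.

Lemma word_rev s : word (rev s) = (word s)^-1.
Proof.
elim: s => [|i s IH]; first by rewrite /word !big_nil invg1.
by rewrite rev_cons word_rcons word_cons invMg IH genV.
Qed.

(* The simple generators generate W_n: in the coset w<gen i>, an element
   maximizing \sum_i i * w(i) has no descent. *)
Lemma gen_wordP w : exists s, w == word s.
Proof.
pose f (v : signed_perm n) := (\sum_(i < n) (i.+1)%:Z * pt_int (v (hi i)))%R.
pose P v := w^-1 * v \in <<[set gen i | i : 'I_n]>>.
have Pw : P w by rewrite /P mulVg group1.
pose v := [arg max_(v > w | P v) f v]%O.
have [Pv vmax] : P v /\ forall u, P u -> (f u <= f v)%R.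
  by rewrite /v; case: Order.TotalTheory.arg_maxP.
have v1 : v = 1.
  apply: all_asc => i; apply/negPn/negP => Ni.
  have /vmax : P (v * gen i).
    by rewrite /P mulgA groupM // mem_gen // imset_f.
  apply/negP; rewrite -Order.TotalTheory.ltNge -Num.Theory.subr_gt0 /f.
  have [D DE] : exists D : 'I_n -> int, forall j,
      D j = ((j.+1)%:Z * (pt_int (v (gen i (hi j))) - pt_int (v (hi j))))%R.
    by eexists.
  rewrite -GRing.sumrB (eq_bigr D); last first.
    by move=> j _; rewrite DE spM GRing.mulrBr.
  have D0 (j : 'I_n) : j <> i -> hi j <> lo i -> D j = 0%R.
    move=> ji jk; rewrite DE; have -> : gen i (hi j) = hi j.
      apply: pt_int_inj; have := lo_hi_int i; have := gen_int i (hi j).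
      have : pt_int (hi j) <> pt_int (hi i) by move/pt_int_inj => [].
      have : pt_int (hi j) <> pt_int (lo i) by move/pt_int_inj.
      rewrite /= [pt_int (hi j)]pt_int_hi.
      move: (pt_int _) (pt_int _) (pt_int _) => a b c.
      by move=> ? ?; case=> [[? ?]|[? ?]|[[? ?]|[? ?]|[? ? ? ? ?]]]; lia.
    by rewrite GRing.subrr GRing.mulr0.
  case: (lo_hi_int i) => -[El Eh].
    have L : lo i = neg_pt (hi i) by apply: pt_int_inj; rewrite pt_int_neg El Eh.
    rewrite (bigD1 i) //= big1 ?GRing.addr0 => [|j /eqP ji]; last first.
      by apply: D0 => //; rewrite L.
    rewrite DE gen_hi; move: Ni; rewrite /asc L sp_neg pt_int_neg.
    by have := @pt_int_neq0 (v (hi i)); lia.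
  have [k kE] : exists k, lo i = hi k.
    move: El; rewrite /lo; case: ifP => _; first by rewrite pt_int_neg.
    by exists (ord_pred i).
  have ki : k <> i by move=> E; move: El Eh; rewrite kE E; lia.
  rewrite (bigD1 i) //= (bigD1 k) /=; last exact/eqP.
  rewrite big1 ?GRing.addr0 => [|j /andP[/eqP ji /eqP jk]]; last first.
    by apply: D0 => //; rewrite kE => -[].
  rewrite !DE gen_hi -kE gen_lo; have := @lo_neq_hi v i; move: Ni; rewrite /asc.
  move: Eh; rewrite kE !pt_int_hi -kE.
  move: (pt_int _) (pt_int _) => a b; nia.
move: Pv; rewrite /P v1 mulg1 => /gen_prodgP[m [c cT cE]].
have [s sE] : exists s, w^-1 = word s.
  rewrite cE; elim: m c cT {cE} => [|m IH] c cT.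
    by exists [::]; rewrite big_ord0 /word big_nil.
  have [|s sE] := IH (fun l : 'I_m => c (lift ord0 l)); first by move=> l; apply: cT.
  have /imsetP[i _ ci] := cT ord0.
  by exists (i :: s); rewrite big_ord_recl sE word_cons ci.
by exists (rev s); rewrite word_rev -sE invgK.
Qed.

Definition expressible w (k : nat) : bool :=
  [exists s : k.-tuple 'I_n, w == word s].

Lemma expressible_ex w : exists k, expressible w k.
Proof.
have [s ws] := gen_wordP w; exists (size s); apply/existsP.
by exists (in_tuple s).
Qed.

Definition length w : nat := ex_minn (expressible_ex w).

Lemma length_word s : length (word s) <= size s.
Proof.
rewrite /length; case: ex_minnP => k _; apply.
by apply/existsP; exists (in_tuple s).
Qed.

Lemma reduced_word w : exists s, w = word s /\ size s = length w.
Proof.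
rewrite /length; case: ex_minnP => k /existsP[s /eqP ws] _.
by exists s; rewrite size_tuple.
Qed.

Lemma length1 : length 1 = 0%N.
Proof.
by apply/eqP; rewrite -leqn0 -[1](_ : word [::] = 1) ?length_word // /word big_nil.
Qed.

Lemma length_mul u v : length (u * v) <= length u + length v.
Proof.
have [s [-> <-]] := reduced_word u; have [r [-> <-]] := reduced_word v.
by rewrite -word_cat -size_cat length_word.
Qed.

Lemma length_gen i : length (gen i) <= 1.
Proof.
by have := length_word [:: i]; rewrite /word big_seq1.
Qed.

Lemma exchange s i : ~~ asc (word s) i ->
  exists2 r, size r < size s & word s * gen i = word r.
Proof.
elim: s => [|j s IH].
  rewrite /word big_nil /asc !sp1 pt_int_lo pt_int_hi.
  by case: ifP; lia.
rewrite word_cons; case: (boolP (asc (word s) i)) => [a|/IH[r rs E] _].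
  case: (asc_gen_mul (word s) i j) => [->|->]; first by rewrite a.
  by move=> _; exists s => //=; rewrite -mulgA gen_sqr mulg1.
by exists (j :: r) => //; rewrite -mulgA E word_cons.
Qed.

Lemma ascE w i : asc w i = (length w < length (w * gen i)).
Proof.
have desc v : ~~ asc v i -> length (v * gen i) < length v.
  have [s [-> <-]] := reduced_word v => /exchange[r rs ->].
  exact: leq_ltn_trans (length_word r) rs.
case: (boolP (asc w i)) => [a|/desc]; last by case: ltngtP.
have := desc (w * gen i); rewrite asc_mul_gen a => /(_ isT).
by rewrite -mulgA gen_sqr mulg1 => ->.
Qed.

Definition is_demazure (op : signed_perm n -> signed_perm n -> signed_perm n) :=
  [/\ associative op,
      forall i, op (gen i) (gen i) = gen i &
      forall u v, length (u * v) = (length u + length v)%N -> op u v = u * v].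

(* R and L are the right and left actions of the generators of the 0-Hecke
   monoid; they commute, which gives the existence of the Demazure product. *)
Let R i w := if asc w i then w * gen i else w.
Let L i w := (R i w^-1)^-1.

Let RL i j w : R j (L i w) = L i (R j w).
Proof.
have LE i' w' : L i' w' = if asc w'^-1 i' then gen i' * w' else w'.
  by rewrite /L /R; case: ifP => _; rewrite ?invMg invgK ?genV.
case: (eqVneq (gen i * w) (w * gen j)) => [E|NE].
  have E' : asc w^-1 i = asc w j.
    rewrite !ascE -E -(genV i) -invMg.
    have lenV v : length v^-1 = length v.
      have le v' : length v'^-1 <= length v'.
        have [s [-> <-]] := reduced_word v'.
        by rewrite -word_rev -(size_rev s) length_word.
      by apply/eqP; rewrite eqn_leq le -{1}[v]invgK le.
    by rewrite !lenV genV.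
  rewrite !LE /R E'; case: (boolP (asc w j)) => a; last first.
    by rewrite (negPf a) E' (negPf a).
  have -> : asc (w * gen j)^-1 i = false.
    by rewrite -E invMg genV asc_mul_gen E' a.
  by rewrite E asc_mul_gen a.
have E1 : asc (gen i * w) j = asc w j.
  by have [//|E] := asc_gen_mul w j i; rewrite E eqxx in NE.
have E2 : asc (w * gen j)^-1 i = asc w^-1 i.
  rewrite invMg genV.
  have [//|E] := asc_gen_mul w^-1 i j.
  move/(congr1 invg): E; rewrite !invMg !invgK !genV => E.
  by rewrite -E eqxx in NE.
rewrite !LE /R.
by case: (boolP (asc w^-1 i)) => a; case: (boolP (asc w j)) => b;
  rewrite ?E1 ?E2 ?a ?b ?(negPf a) ?(negPf b) ?mulgA.
Qed.

Let act s u := foldl (fun u i => R i u) u s.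
Let lact s u := (act s u^-1)^-1.

Let act_lact s r u : act s (lact r u) = lact r (act s u).
Proof.
have Rl i v : R i (lact r v) = lact r (R i v).
  rewrite /lact; elim: r v => [|j r IH] v /=; first by rewrite !invgK.
  have Rj v' : R j v'^-1 = (L j v')^-1 by rewrite /L invgK.
  by rewrite !Rj IH RL.
by elim: s u => //= i s IH u; rewrite Rl IH.
Qed.

Let act_word s u :
  length (u * word s) = (length u + size s)%N -> act s u = u * word s.
Proof.
elim: s u => [|i s IH] u /=; first by rewrite /word big_nil mulg1.
rewrite word_cons mulgA => E.
have l1 := length_mul u (gen i); have l2 := length_gen i.
have l3 := length_mul (u * gen i) (word s); have l4 := length_word s.
rewrite E in l3.
have lu : length (u * gen i) = (length u).+1 by lia.
have -> : R i u = u * gen i by rewrite /R ascE lu ltnSn.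
by apply: IH; rewrite E lu addnS.
Qed.

Let act_inj s r : act s 1 = act r 1 -> forall u, act s u = act r u.
Proof.
move=> E u; have [q [qE qs]] := reduced_word u^-1.
have -> : u = lact q 1.
  rewrite /lact invg1 act_word ?mul1g ?length1 // -?qE ?invgK //.
by rewrite !act_lact E.
Qed.

Lemma demazure_exists : {op | is_demazure op}.
Proof.
have red w : {s | w == word s & size s == length w}.
  have ex : exists s, (w == word s) && (size s == length w).
    by have [s [ws ss]] := reduced_word w; exists s; rewrite ss -ws !eqxx.
  by exists (xchoose ex); have /andP[] := xchooseP ex.
pose rw w := s2val (red w).
have rwE w : w = word (rw w) by apply/eqP; rewrite /rw; case: (red w).
have rws w : size (rw w) = length w by apply/eqP; rewrite /rw; case: (red w).
have act1 w : act (rw w) 1 = w.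
  by rewrite act_word -?rwE mul1g // length1 rws.
have act_cat s r u : act (s ++ r) u = act r (act s u) by rewrite /act foldl_cat.
exists (fun u v => act (rw v) u); split.
- move=> u v w; rewrite -act_cat; apply: act_inj.
  by rewrite act_cat !act1.
- move=> i; have a1 : asc 1 i.
    by rewrite /asc !sp1; have := lo_hi_int i; rewrite /=; lia.
  have ag : asc (gen i) i = false by rewrite -[gen i]mul1g asc_mul_gen a1.
  rewrite (act_inj (r := [:: i])) /=; first by rewrite /R ag.
  by rewrite act1 /R a1 mul1g.
move=> u v uv; rewrite [in RHS](rwE v) act_word //.
by rewrite -rwE rws.
Qed.

Lemma demazure_unique op1 op2 : is_demazure op1 -> is_demazure op2 ->
  forall u v, op1 u v = op2 u v.
Proof.
have opR op : is_demazure op -> forall u i, op u (gen i) = R i u.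
  move=> [oA oi om] u i; rewrite /R.
  have step v : asc v i -> op v (gen i) = v * gen i.
    rewrite ascE => a; apply: om.
    have := length_mul v (gen i); have := length_gen i.
    case: (posnP (length (gen i))) => [z|]; last by lia.
    by have := length_mul v (gen i); lia.
  case: (boolP (asc u i)) => [/step//|d].
  have a : asc (u * gen i) i by rewrite asc_mul_gen.
  have uE : u = op (u * gen i) (gen i) by rewrite step // -mulgA gen_sqr mulg1.
  by rewrite {1}uE -oA oi -uE.
have opact op : is_demazure op -> forall s u, size s = length (word s) ->
    op u (word s) = act s u.
  move=> D; have [oA oi om] := D; elim/last_ind => [|s i IH] u.
    by move=> _; rewrite /word big_nil om ?mulg1 // length1 addn0.
  rewrite size_rcons word_rcons => E.
  have l1 := length_mul (word s) (gen i); have l2 := length_gen i.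
  have l3 := length_word s.
  have -> : word s * gen i = op (word s) (gen i) by rewrite om //; lia.
  by rewrite oA (opR _ D) IH /act ?foldl_rcons //; lia.
move=> D1 D2 u v; have [s [-> ss]] := reduced_word v.
by rewrite !opact // -ss //; have := reduced_word v.
Qed.

Definition demazure : signed_perm n -> signed_perm n -> signed_perm n :=
  sval demazure_exists.

Lemma demazureP : is_demazure demazure.
Proof. exact: (svalP demazure_exists). Qed.

Definition involution w : bool := w == w^-1.

Definition hecke_atoms z : {set signed_perm n} :=
  [set w | demazure w^-1 w == z].

Definition atoms z : {set signed_perm n} :=
  [set w in hecke_atoms z | [forall v in hecke_atoms z, length w <= length v]].

Definition negated_points z : {set 'I_n} :=
  [set i | z (pos i) == neg_pt (pos i)].

End Generators.

Definition single_atom_involutions n : {set signed_perm n} :=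
  [set z | involution z && (#|atoms z| == 1)%N].

(* a_n and a_n^k *)
Definition num_single n : nat := #|single_atom_involutions n|.

Definition num_single_neg n k : nat :=
  #|[set z in single_atom_involutions n | #|negated_points z| == k]|.

(* Main.v *)
Require Import Defs.
From mathcomp Require Import all_boot all_order all_algebra all_fingroup.
From mathcomp Require Import zify ring.

(* The atoms of an involution z are the products of the chains that lead from 1
   to z by steps y -> s o y o s with s an ascent of y. If w is an atom of z and z
   has at most one negated point, then the one-line notation of w^-1 lists b
   before a for every cycle a < b of z on [+-n], with no value of ]a, b[ in
   between, and lists non-nested cycles one after the other. Hence w is unique if
   no cycle is nested in another one, except for non-symmetric cycles nested in
   {-m, m}. Conversely, any other nesting survives in z_s = s o z o s for some
   descent s, until its end points are adjacent; the descents at these end points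
   then contradict the order above if there is a single atom.

   The remaining z are determined by the word recording, for i = n, ..., 1,
   whether i closes a cycle, opens a cycle, is fixed or is negated. The number
   of cycles that are open performs a walk reflected at 0, and the words without
   negated point correspond to the walks ending at an even height. By the
   reflection principle their number is the sum of the 'C(n, i) for i >= n/2;
   those with a negated point are floor(n/2) + 1 times the sum of the 'C(n, i)
   for i > n/2. *)

Set Implicit Arguments.
Unset Strict Implicit.
Unset Printing Implicit Defensive.

Local Notation "x <: y" := (pt_int x < pt_int y)%R (at level 70, no associativity).
Local Notation "x <=: y" := (pt_int x <= pt_int y)%R (at level 70, no associativity).

(** * Atoms as products of chains of involutions *)

Section Atoms.
Local Open Scope group_scope.
Variable n : nat.
Implicit Types (u v w y z : signed_perm n) (i j : 'I_n) (x : pt n).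

(** The order relations are used as necessary conditions on an atom. This suffices: an atom is
    obtained by descending from z to 1, and for a good z the relations already compare any two
    points. They are proved along a chain and need not survive a commuting step with y(i) = -(i+1),
    which creates the negated points i and i+1 together. Hence [few_neg], and hence, in the
    converse, the exclusion of two negated points before the order is used. The converse is an
    induction: the involutions just below z inherit a single atom, so they are good, and every
    descent of z must destroy every forbidden nesting of z. This confines the nestings to adjacent
    end points. As for the factor floor(n/2) + 1: if [lM] is read with q letters left, the walk must
    stand at height at most q. Higher walks cannot meet the boundary any more, so all their 2^q
    continuations are possible. Subtracting them for each position of [lM] leaves n times one tail
    minus a weighted sum of tails, which [tail_sumE] collapses. *)

Lemma signed_invM u v : (u * v)^-1 = v^-1 * u^-1.
Proof. exact: invMg. Qed.

Lemma length_inv w : length w^-1 = length w.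
Proof.
have le v : length v^-1 <= length v.
  have [s [-> <-]] := reduced_word v.
  by rewrite -word_rev -(size_rev s) length_word.
by apply/eqP; rewrite eqn_leq le -{1}[w]invgK le.
Qed.

Lemma length_mul_gen w i : asc w i -> length (w * gen i) = (length w).+1.
Proof.
by rewrite ascE; have := length_mul w (gen i); have := length_gen i; lia.
Qed.

Lemma length_mul_gen_desc w i : ~~ asc w i -> length w = (length (w * gen i)).+1.
Proof.
move=> d; rewrite -(@length_mul_gen _ i) ?asc_mul_gen //.
by rewrite -mulgA gen_sqr mulg1.
Qed.

Lemma length_gen_eq1 i : length (gen i) = 1%N.
Proof.
rewrite -[gen i]mul1g length_mul_gen ?length1 // /asc !sp1.
by have := lo_hi_int i; rewrite /=; lia.
Qed.

Local Notation "u \o' v" := (demazure u v) (at level 40, left associativity).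

Lemma demazureA : associative (@demazure n).
Proof. by case: (demazureP n). Qed.

Lemma demazure_mul u v : length (u * v) = (length u + length v)%N -> u \o' v = u * v.
Proof. by case: (demazureP n) => _ _; apply. Qed.

Lemma demazure_idem i : gen i \o' gen i = gen i.
Proof. by case: (demazureP n). Qed.

Lemma demazure_genr u i : u \o' gen i = if asc u i then u * gen i else u.
Proof.
have step v : asc v i -> v \o' gen i = v * gen i.
  by move=> a; apply: demazure_mul; rewrite length_mul_gen // length_gen_eq1 addn1.
case: ifPn => [/step//|d].
have uE : u = (u * gen i) \o' gen i.
  by rewrite step ?asc_mul_gen // -mulgA gen_sqr mulg1.
by rewrite {1}uE -demazureA demazure_idem.
Qed.

Lemma demazure_genl u i : gen i \o' u = if asc u^-1 i then gen i * u else u.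
Proof.
have step v : asc v^-1 i -> gen i \o' v = gen i * v.
  move=> a; apply: demazure_mul.
  have -> : length (gen i * v) = length (v^-1 * gen i).
    by rewrite -length_inv signed_invM Defs.genV.
  by rewrite length_mul_gen // length_gen_eq1 length_inv.
case: ifPn => [/step//|d].
have uE : u = gen i \o' (gen i * u).
  have a : asc (gen i * u)^-1 i by rewrite signed_invM Defs.genV asc_mul_gen.
  by rewrite step // mulgA gen_sqr mul1g.
by rewrite {1}uE demazureA demazure_idem.
Qed.

(** At an ascent of an involution [y] this is s o y o s with s = [gen i]; at a descent the same
    formula undoes such a step, see [conj_stepK]. *)
Definition conj_step y i : signed_perm n :=
  if gen i * y == y * gen i then y * gen i else gen i * y * gen i.

Lemma demazure_conj_step y i : involution y ->
  gen i \o' y \o' gen i = if asc y i then conj_step y i else y.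
Proof.
move=> /eqP yV; rewrite demazure_genl -yV /conj_step.
case: ifPn => a; last by rewrite demazure_genr (negPf a).
rewrite demazure_genr; case: eqP => [->|ne]; first by rewrite asc_mul_gen a.
by have [->|//] := asc_gen_mul y i i; rewrite a.
Qed.

Lemma conj_step_involution y i : involution y -> involution (conj_step y i).
Proof.
move/eqP=> yV; rewrite /conj_step /involution.
case: (gen i * y =P y * gen i) => [c|_].
  by rewrite signed_invM -yV Defs.genV c.
by rewrite !signed_invM -yV Defs.genV mulgA.
Qed.

Lemma asc_conj_step y i : asc y i -> asc (conj_step y i) i = false.
Proof.
move=> a; rewrite /conj_step; case: eqP => c; rewrite asc_mul_gen ?a //.
by have [->|//] := asc_gen_mul y i i; rewrite a.
Qed.

Lemma conj_stepK z i : ~~ asc z i -> conj_step (conj_step z i) i = z.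
Proof.
move=> d; rewrite /conj_step; case: (altP (gen i * z =P z * gen i)) => c.
  by rewrite mulgA c eqxx -mulgA gen_sqr mulg1.
case: eqP => [E|_]; last by rewrite !mulgA gen_sqr mul1g -mulgA gen_sqr mulg1.
case/eqP: c; move: E; rewrite !mulgA gen_sqr mul1g => E.
by rewrite E -!mulgA gen_sqr mulg1.
Qed.

Lemma asc_conj_step_desc z i : ~~ asc z i -> asc (conj_step z i) i.
Proof.
move=> d; rewrite /conj_step; case: eqP => c; rewrite asc_mul_gen //.
by have [->|//] := asc_gen_mul z i i.
Qed.

Definition nfix z : nat := #|[pred x | z x == x]|.
Definition nneg z : nat := #|[pred x | z x == neg_pt x]|.

Lemma gen_neg i x : gen i (neg_pt x) = neg_pt (gen i x).
Proof. exact: sp_neg. Qed.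

Lemma card_conj z i (h : pt n -> pt n) : (forall x, h (gen i x) = gen i (h x)) ->
  #|[pred x | (gen i * z * gen i) x == h x]| = #|[pred x | z x == h x]|.
Proof.
move=> hg; rewrite -(card_image (@perm_inj _ (gen i))) .
apply: eq_card => x; rewrite [RHS]inE; apply/imageP/eqP => [[y]|E].
  by rewrite inE !spM => /eqP E ->; rewrite hg -E genK.
exists (gen i x); rewrite ?genK // inE hg; apply/eqP.
by rewrite !spM genK E.
Qed.

Lemma invol_inv z x : involution z -> z (z x) = x.
Proof. by move/eqP=> {1}->; rewrite permK. Qed.

(** Commutation makes [gen i] reverse the pair y(lo i) < y(hi i), and [gen_inversion] leaves two
    candidates for such a pair, which coincide for [i] = 0. *)
Lemma comm_gen y i : involution y -> asc y i -> gen i * y = y * gen i ->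
  (y (lo i) = lo i /\ y (hi i) = hi i) \/
  [/\ i != 0 :> nat, y (lo i) = neg_pt (hi i) & y (hi i) = neg_pt (lo i)].
Proof.
move=> yV a c.
have cx x : gen i (y x) = y (gen i x) by rewrite -!spM c.
have := asc_conj_step a; rewrite /conj_step c eqxx /asc !spM gen_lo gen_hi => d.
move: (a); rewrite /asc => a'.
have := @gen_inversion _ i (y (lo i)) (y (hi i)) a'.
rewrite !cx gen_lo gen_hi => /(_ a') [[-> ->]|[-> ->]]; first by left.
case: (eqVneq (i : nat) 0) => i0; last by right.
by left; rewrite /lo i0 /hi /= neg_ptK.
Qed.

Lemma card_agree_out (P Q S : pred (pt n)) : (forall x, x \notin S -> P x = Q x) ->
  (#|P| + #|[predI Q & S]| = #|Q| + #|[predI P & S]|)%N.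
Proof.
move=> PQ; rewrite -(cardID S P) -(cardID S Q).
have -> : #|[predD P & S]| = #|[predD Q & S]|.
  apply: eq_card => x; rewrite !inE; case: (boolP (x \in S)) => //= xS.
  by rewrite !unfold_in PQ.
by lia.
Qed.

Lemma card_full (P S : pred (pt n)) : {subset S <= P} -> #|[predI P & S]| = #|S|.
Proof.
move=> SP; apply: eq_card => x; rewrite !inE; case: (boolP (x \in S)) => [/SP ->|] //.
by rewrite andbF.
Qed.

Lemma card_none (P S : pred (pt n)) : (forall x, x \in S -> ~~ P x) ->
  #|[predI P & S]| = 0%N.
Proof.
move=> SP; apply: eq_card0 => x; rewrite !inE; case: (boolP (x \in S)) => [/SP|].
  by rewrite unfold_in andbT => /negPf.
by rewrite andbF.
Qed.

Definition moved i : seq (pt n) := [:: lo i; hi i; neg_pt (lo i); neg_pt (hi i)].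

Lemma gen_out i x : x \notin moved i -> gen i x = x.
Proof. by rewrite !inE !negb_or genE => /and4P[/negPf-> /negPf-> /negPf-> /negPf->]. Qed.

Lemma lo_neq_neghi i : i != 0 :> nat -> lo i != neg_pt (hi i).
Proof.
move=> i0; rewrite eq_pt_int pt_int_neg pt_int_lo (negPf i0) pt_int_hi.
by apply/eqP; lia.
Qed.

Lemma lo0 i : i = 0 :> nat -> lo i = neg_pt (hi i).
Proof. by move=> i0; rewrite /lo i0. Qed.

Lemma lo_hiN i : lo i != hi i.
Proof. by rewrite eq_pt_int; have := lo_hi_int i; case: eqP => //=; lia. Qed.

Lemma neg_ptN x : (neg_pt x == x) = false.
Proof. by apply/eqP; exact: neg_pt_neq. Qed.

Lemma card_moved i : #|[pred x in moved i]| = if i == 0 :> nat then 2%N else 4.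
Proof.
have -> : #|[pred x in moved i]| = #|moved i| by apply: eq_card => x; rewrite !inE.
case: ifPn => i0.
  rewrite -[2%N]/(size [:: lo i; hi i]).
  rewrite -(card_uniqP (_ : uniq [:: lo i; hi i])) /= ?inE ?lo_hiN //.
  apply: eq_card => x; rewrite !inE lo0 ?neg_ptK; last exact/eqP.
  by case: (x == hi i); case: (x == neg_pt (hi i)).
have nl (x x' : pt n) : (neg_pt x == neg_pt x') = (x == x').
  by rewrite (inj_eq (can_inj (@neg_ptK n))).
have hl : hi i != neg_pt (lo i) by rewrite -nl neg_ptK eq_sym lo_neq_neghi.
apply/card_uniqP; rewrite /moved /= !inE !negb_or nl lo_hiN lo_neq_neghi // hl.
by rewrite -![_ i == neg_pt (_ i)]eq_sym !neg_ptN.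
Qed.

(* 2n minus the trace of z on the points, i.e. four times the dimension of the
   (-1)-eigenspace of z acting on R^n *)
Definition cotrace z : nat := nneg z + (#|pt n| - nfix z).
(* eight times the length of the atoms of z, see chain_atom_hecke *)
Definition rank8 z : nat := 4 * length z + cotrace z.

Lemma nfix_le z : nfix z <= #|pt n|.
Proof. exact: max_card. Qed.

(** A conjugation adds 2 to the length and keeps [cotrace]. A commuting step adds only 1, and
    [cotrace] makes up for it by 4: two points ([i] = 0) turn from fixed to negated, or four points
    cease to be fixed, or four points become negated. *)
Lemma rank8_conj_step y i : involution y -> asc y i ->
  rank8 (conj_step y i) = (rank8 y + 8)%N.
Proof.
move=> yV a; have fy := nfix_le y; have fz := nfix_le (conj_step y i).
rewrite /rank8 /cotrace; move: fz; rewrite /conj_step; case: eqP => [c|nc] fz; last first.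
  have -> : nneg (gen i * y * gen i) = nneg y by apply: card_conj => x; rewrite gen_neg.
  have -> : nfix (gen i * y * gen i) = nfix y by exact: (@card_conj _ _ id).
  rewrite length_mul_gen; last by have [->|//] := asc_gen_mul y i i.
  have -> : length (gen i * y) = (length y).+1; last by lia.
  rewrite -(length_mul_gen a).
  by rewrite -[RHS]length_inv signed_invM Defs.genV -(eqP yV).
rewrite length_mul_gen //.
pose S := [pred x in moved i].
have agr x : x \notin S -> (y * gen i) x = y x.
  by rewrite inE => xS; rewrite spM gen_out.
pose z := y * gen i.
have f1 : (nfix y + #|[predI [pred x | z x == x] & S]| =
           nfix z + #|[predI [pred x | y x == x] & S]|)%N.
  by apply: card_agree_out => x xS; rewrite /= agr.
have n1 : (nneg y + #|[predI [pred x | z x == neg_pt x] & S]| =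
           nneg z + #|[predI [pred x | y x == neg_pt x] & S]|)%N.
  by apply: card_agree_out => x xS; rewrite /= agr.
have S_all (P : pred (pt n)) : (forall x, P (neg_pt x) = P x) ->
    P (lo i) -> P (hi i) -> forall x, x \in S -> P x.
  by move=> PN Pl Ph x; rewrite !inE => /or4P[] /eqP->; rewrite ?PN.
have eN u x : (u (neg_pt x) == neg_pt x) = (u x == x).
  by rewrite sp_neg (inj_eq (can_inj (@neg_ptK n))).
have nN u x : (u (neg_pt x) == neg_pt (neg_pt x)) = (u x == neg_pt x).
  by rewrite sp_neg (inj_eq (can_inj (@neg_ptK n))).
have lh := lo_hiN i; have hl : hi i != lo i by rewrite eq_sym.
have nl (x x' : pt n) : (neg_pt x == neg_pt x') = (x == x').
  by rewrite (inj_eq (can_inj (@neg_ptK n))).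
have zl : z (lo i) = y (hi i) by rewrite /z spM gen_lo.
have zh : z (hi i) = y (lo i) by rewrite /z spM gen_hi.
have cS : #|S| = if i == 0 :> nat then 2%N else 4 by exact: card_moved.
have [[yl yh]|[i0 yl yh]] := comm_gen yV a c.
  rewrite (card_none (P := [pred x | z x == x])) in f1; last first.
    apply: (S_all (fun x => z x != x)) => [x||]; first by rewrite eN.
      by rewrite zl yh.
    by rewrite zh yl.
  rewrite (card_full (P := [pred x | y x == x])) in f1; last first.
    by apply: (S_all [pred x | y x == x]) => [x||]; rewrite inE ?eN ?inE ?yl ?yh.
  rewrite (card_none (P := [pred x | y x == neg_pt x])) in n1; last first.
    apply: (S_all (fun x => y x != neg_pt x)) => [x||]; first by rewrite nN.
      by rewrite yl eq_sym neg_ptN.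
    by rewrite yh eq_sym neg_ptN.
  have [i0|i0] := eqVneq (i : nat) 0%N.
    rewrite (card_full (P := [pred x | z x == neg_pt x])) in n1; last first.
      apply: (S_all [pred x | z x == neg_pt x]) => [x||]; rewrite inE.
      - by rewrite nN.
      - by rewrite zl yh (lo0 i0) neg_ptK.
      - by rewrite zh yl (lo0 i0).
    move: f1 n1; rewrite /z cS i0 eqxx; lia.
  rewrite (card_none (P := [pred x | z x == neg_pt x])) in n1; last first.
    apply: (S_all (fun x => z x != neg_pt x)) => [x||]; first by rewrite nN.
      by rewrite zl yh -nl neg_ptK eq_sym lo_neq_neghi.
    by rewrite zh yl lo_neq_neghi.
  move: f1 n1; rewrite /z cS (negPf i0); lia.
have lnh := lo_neq_neghi i0.
have hnl : hi i != neg_pt (lo i) by rewrite -nl neg_ptK eq_sym.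
rewrite (card_none (P := [pred x | z x == x])) in f1; last first.
  apply: (S_all (fun x => z x != x)) => [x||]; first by rewrite eN.
    by rewrite zl yh neg_ptN.
  by rewrite zh yl neg_ptN.
rewrite (card_none (P := [pred x | y x == x])) in f1; last first.
  apply: (S_all (fun x => y x != x)) => [x||]; first by rewrite eN.
    by rewrite yl eq_sym.
  by rewrite yh eq_sym.
rewrite (card_none (P := [pred x | y x == neg_pt x])) in n1; last first.
  apply: (S_all (fun x => y x != neg_pt x)) => [x||]; first by rewrite nN.
    by rewrite yl nl.
  by rewrite yh nl.
rewrite (card_full (P := [pred x | z x == neg_pt x])) in n1; last first.
  apply: (S_all [pred x | z x == neg_pt x]) => [x||]; rewrite inE.
  - by rewrite nN.
  - by rewrite zl yh.
  - by rewrite zh yl.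
move: f1 n1; rewrite /z cS (negPf i0); lia.
Qed.

(** Ascents are required of [y] only; that [i] is then an ascent of [v], so that the product is
    reduced, is derived in [chain_atom_asc]. *)
Inductive chain_atom : signed_perm n -> signed_perm n -> Prop :=
| chain_atom1 : chain_atom 1 1
| chain_atom_step v y i : chain_atom v y -> asc y i ->
    chain_atom (v * gen i) (conj_step y i).

Lemma involution1 : involution (1 : signed_perm n).
Proof. by rewrite /involution invg1. Qed.

Lemma chain_atom_involution w z : chain_atom w z -> involution z.
Proof. by elim=> [|v y i _ IH a]; [exact: involution1|exact: conj_step_involution]. Qed.

Lemma demazure_1l w : demazure 1 w = w.
Proof. by rewrite demazure_mul ?mul1g // length1. Qed.

Lemma hecke_mul_gen v i : asc v i ->
  demazure (v * gen i)^-1 (v * gen i) =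
  demazure (demazure (gen i) (demazure v^-1 v)) (gen i).
Proof.
move=> a; have E : v * gen i = demazure v (gen i) by rewrite demazure_genr a.
have EV : (v * gen i)^-1 = demazure (gen i) v^-1.
  by rewrite demazure_genl invgK a signed_invM Defs.genV.
by rewrite EV E !demazureA.
Qed.

Lemma nneg1 : nneg 1 = 0%N.
Proof. by apply: eq_card0 => x; rewrite inE sp1 eq_sym neg_ptN. Qed.

Lemma nfix1 : nfix 1 = #|pt n|.
Proof. by apply: eq_card => x; rewrite inE sp1 eqxx. Qed.

(** Removing a last letter from [w] either leaves z unchanged or undoes one [conj_step], which is
    worth 8. So [rank8] bounds the length of all Hecke atoms from below, and equality means that no
    letter was absorbed. *)
Lemma hecke_rank w : let z := demazure w^-1 w in
  [/\ involution z, rank8 z <= 8 * length w &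
    rank8 z = (8 * length w)%N -> chain_atom w z].
Proof.
have [m] := ubnP (length w); elim: m w => // m IH w.
have [->|w1] := eqVneq w 1.
  move=> _; rewrite invg1 demazure_1l length1; split=> //; [exact: involution1| |].
    by rewrite /rank8 length1 /cotrace nneg1 nfix1 subnn.
  by move=> _; exact: chain_atom1.
have [i di] : exists i, ~~ asc w i.
  apply/existsP; rewrite -negb_forall; apply: contra w1 => /forallP wa.
  by apply/eqP; exact: all_asc.
set v := w * gen i; have wE : w = v * gen i by rewrite -mulgA gen_sqr mulg1.
have av : asc v i by rewrite asc_mul_gen.
rewrite wE (length_mul_gen av) => lv.
have [yV yr ya] := IH v lv.
rewrite /= hecke_mul_gen // demazure_conj_step //; case: ifP => a.
  split; [exact: conj_step_involution|by rewrite rank8_conj_step //; lia|].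
  by rewrite rank8_conj_step // => e; apply: chain_atom_step => //; apply: ya; lia.
by split=> //; lia.
Qed.

Lemma chain_atom_hecke w z : chain_atom w z ->
  demazure w^-1 w = z /\ rank8 z = (8 * length w)%N.
Proof.
elim=> [|v y i vy [E r] a].
  rewrite invg1 demazure_1l; split=> //.
  have [_] := hecke_rank 1; rewrite invg1 demazure_1l length1; lia.
have yV := chain_atom_involution vy.
have av : asc v i.
  (* If [i] were a descent of [v], both factors s would be absorbed and s o y o s = y, although the
     step raises [rank8]. *)
  apply/negPn/negP => dv.
  have vE : v = demazure v (gen i) by rewrite demazure_genr (negPf dv).
  have vVE : v^-1 = demazure (gen i) v^-1 by rewrite demazure_genl invgK (negPf dv).
  have := demazure_conj_step i yV; rewrite a -E !demazureA -vVE -demazureA -vE E => e.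
  by have := rank8_conj_step yV a; rewrite -e; lia.
rewrite hecke_mul_gen // E demazure_conj_step // a; split=> //.
by rewrite rank8_conj_step // length_mul_gen //; lia.
Qed.

Lemma chain_atom_exists z : involution z -> exists w, chain_atom w z.
Proof.
have [m] := ubnP (rank8 z); elim: m z => // m IH z.
have [-> _ _|z1 lz zV] := eqVneq z 1; first by exists 1; exact: chain_atom1.
have [i di] : exists i, ~~ asc z i.
  apply/existsP; rewrite -negb_forall; apply: contra z1 => /forallP wa.
  by apply/eqP; exact: all_asc.
have yV := conj_step_involution i zV; have ay := asc_conj_step_desc di.
have := rank8_conj_step yV ay; rewrite conj_stepK // => r.
have [|v vy] := IH _ _ yV; first by lia.
by exists (v * gen i); rewrite -[z](conj_stepK di); apply: chain_atom_step.
Qed.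

(** Some chain attains the lower bound of [hecke_rank], so minimal length amounts to equality
    there. *)
Lemma atomsP w z : involution z -> (w \in atoms z) <-> chain_atom w z.
Proof.
move=> zV; have [w0 w0z] := chain_atom_exists zV; have [E0 r0] := chain_atom_hecke w0z.
rewrite !inE; split=> [/andP[/eqP E /forall_inP mw]|wz].
  have [_ le ia] := hecke_rank w; rewrite E in le ia; apply: ia.
  by have := mw w0; rewrite inE E0 eqxx => /(_ isT); lia.
have [E r] := chain_atom_hecke wz; rewrite E eqxx /=.
apply/forall_inP => v; rewrite inE => /eqP Ev.
by have [_] := hecke_rank v; rewrite Ev; lia.
Qed.

Lemma chain_atom_asc v y i : chain_atom v y -> asc y i -> asc v i.
Proof.
move=> vy ay; have [_ r] := chain_atom_hecke vy.
have [_] := chain_atom_hecke (chain_atom_step vy ay).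
rewrite (rank8_conj_step (chain_atom_involution vy) ay).
by case: (boolP (asc v i)) => // /length_mul_gen_desc; lia.
Qed.

End Atoms.

(** * The order imposed on atoms by the cycles *)

Section Order.
Local Open Scope group_scope.
Variable n : nat.
Implicit Types (u v w y z : signed_perm n) (i j : 'I_n) (x a b : pt n).

Definition few_neg z : Prop := forall x a,
  z x = neg_pt x -> z a = neg_pt a -> a = x \/ a = neg_pt x.

Lemma conj_stepE_comm y i x : gen i * y = y * gen i -> conj_step y i x = y (gen i x).
Proof. by move=> c; rewrite /conj_step c eqxx spM. Qed.

Lemma conj_stepE_conj y i x : gen i * y <> y * gen i ->
  conj_step y i x = gen i (y (gen i x)).
Proof. by move/eqP=> /negPf c; rewrite /conj_step c !spM. Qed.

Lemma negated_conj_step y i x : involution y -> asc y i -> y x = neg_pt x ->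
  conj_step y i (gen i x) = neg_pt (gen i x).
Proof.
move=> yV a yx; case: (eqVneq (gen i * y) (y * gen i)) => [c|/eqP nc]; last first.
  by rewrite conj_stepE_conj // genK yx gen_neg.
rewrite conj_stepE_comm // genK yx; congr neg_pt; apply/esym/gen_out.
have E b c' : neg_pt b = neg_pt c' -> b = c' by apply: (can_inj (@neg_ptK n)).
have lh := lo_hiN i; have nl b := @neg_pt_neq n b.
have [[yl yh]|[i0 yl yh]] := comm_gen yV a c; rewrite !inE; apply/negP.
  case/or4P=> /eqP xe; move: yx; rewrite xe ?sp_neg ?yl ?yh.
  - by move/esym/nl.
  - by move/esym/nl.
  - by move/E/esym/nl.
  by move/E/esym/nl.
case/or4P=> /eqP xe; move: yx; rewrite xe ?sp_neg ?yl ?yh.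
- by move/E/esym/eqP; rewrite (negPf lh).
- by move/E/eqP; rewrite (negPf lh).
- by rewrite ?neg_ptK => /esym/eqP; rewrite (negPf lh).
by rewrite ?neg_ptK => /eqP; rewrite (negPf lh).
Qed.

Lemma few_neg_conj_step y i : involution y -> asc y i ->
  few_neg (conj_step y i) -> few_neg y.
Proof.
move=> yV a fz x b yx yb.
have [e|e] := fz _ _ (negated_conj_step yV a yx) (negated_conj_step yV a yb).
  by left; rewrite -[b](genK i) e genK.
by right; rewrite -[b](genK i) e gen_neg genK.
Qed.

Lemma comm_gen_few y i : involution y -> asc y i -> few_neg (conj_step y i) ->
  gen i * y = y * gen i -> y (lo i) = lo i /\ y (hi i) = hi i.
Proof.
move=> yV a fz c; have [//|[i0 yl yh]] := comm_gen yV a c; exfalso.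
have := @fz (lo i) (hi i).
rewrite !conj_stepE_comm // gen_lo gen_hi yl yh => /(_ erefl erefl)[e|e].
  by have := lo_hiN i; rewrite e eqxx.
by have := lo_neq_neghi i0; rewrite e neg_ptK eqxx.
Qed.

(** The pairs of neighbouring points x < a exchanged by [gen i]; as 0 is not a point, -1 and 1 are
    neighbours. By [gen_mono], [gen i] preserves the order of all other pairs. *)
Definition simple i x a : Prop :=
  (x = lo i /\ a = hi i) \/ (x = neg_pt (hi i) /\ a = neg_pt (lo i)).

Lemma simple_gen i x a : simple i x a -> gen i x = a /\ gen i a = x.
Proof. by case=> -[-> ->]; rewrite ?gen_neg gen_lo gen_hi. Qed.

Lemma simple_asc y i x a : asc y i -> simple i x a -> y x <: y a.
Proof. by rewrite /asc => ya [] [-> ->]; rewrite ?sp_neg ?pt_int_neg //; lia. Qed.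

Lemma simple_adj i x a b : simple i x a -> x <: b -> a <=: b.
Proof.
have := lo_hi_int i; have := @pt_int_neq0 n b.
by rewrite /= => b0 lh [] [-> ->]; rewrite ?pt_int_neg; lia.
Qed.

Lemma simple_adjr i x a b : simple i x a -> b <: a -> b <=: x.
Proof.
have := lo_hi_int i; have := @pt_int_neq0 n b.
by rewrite /= => b0 lh [] [-> ->]; rewrite ?pt_int_neg; lia.
Qed.

Lemma le_neq_lt x a : x <=: a -> x <> a -> x <: a.
Proof. by move=> le ne; have : pt_int x <> pt_int a by [move/pt_int_inj]; lia. Qed.

Lemma gen_mono i x a : x <: a -> gen i x <: gen i a \/ simple i x a.
Proof.
move=> xa; case: (Order.TotalTheory.ltgtP (pt_int (gen i x)) (pt_int (gen i a))) => [|ga|].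
- by left.
- by right; exact: gen_inversion ga.
by move/pt_int_inj/perm_inj=> e; move: xa; rewrite e; lia.
Qed.

Lemma simple_comm y i x a : simple i x a -> simple i (y x) (y a) ->
  gen i * y = y * gen i.
Proof.
move=> s1 s2; apply: gen_conj.
have nK b c : neg_pt b = c -> b = neg_pt c by move=> <-; rewrite neg_ptK.
case: s1 s2 => -[-> ->] [] []; rewrite ?sp_neg; [by left|by right| |].
  by move=> /nK e1 /nK e2; right.
by move=> /nK e1 /nK e2; left; rewrite e1 e2 !neg_ptK.
Qed.

(* For w in A(z), the one-line notation of w^-1 lists b before a for each cycle
   a < b = z a, with no value of ]a, b[ in between, and it lists non-nested
   cycles one after the other. *)
Definition atom_order w z : Prop :=
  [/\ forall a, a <: z a -> w (z a) <: w a,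
      forall a b, a <=: z a -> b <=: z b -> a <: b -> z a <: z b -> w a <: w (z b)
    & forall a x, a <: x -> x <: z a -> w (z a) <: w x -> w x <: w a -> False].

(** [gen i] carries the cycles of z to those of [y], so each condition is pulled back from [v] and
    [y], except where [gen i] exchanges two of the points compared. There the ascents of [y] and [v]
    decide. *)
Lemma atom_order_conj v y i : involution y -> asc y i -> asc v i ->
    gen i * y <> y * gen i ->
  atom_order v y -> atom_order (v * gen i) (conj_step y i).
Proof.
move=> yV ya va nc [P1 P2 P3]; set z := conj_step y i.
have zg a : gen i (z a) = y (gen i a) by rewrite /z conj_stepE_conj // genK.
have zg' a : z a = gen i (y (gen i a)) by rewrite -zg genK.
have yy a : y (y a) = a by exact: invol_inv.
have L a : a <: z a -> gen i a <: y (gen i a).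
  move=> az; have [|s] := gen_mono i az; first by rewrite zg.
  have := simple_asc ya s; have [s1 s2] := simple_gen s.
  have e : y (z a) = a by rewrite -s1 -zg s2.
  have e2 : y a = z a by rewrite -{1}e yy.
  by rewrite e e2; lia.
have Le a : a <=: z a -> gen i a <=: y (gen i a).
  case: (eqVneq (z a) a) => [e|ne az].
    by rewrite -zg e.
  suff : gen i a <: y (gen i a) by lia.
  by apply: L; move: ne; rewrite eq_pt_int => /eqP; lia.
split.
- by move=> a /L /P1; rewrite !spM zg.
- move=> a b az bz ab zab; rewrite !spM zg.
  (* If a, b are exchanged, the ascent of [y] forces z a, z b to be exchanged too; then [y] maps one
     simple pair to another and commutes with [gen i]. *)
  have [gab|s] := gen_mono i ab; last first.
    exfalso; have := simple_asc ya s; have [s1 s2] := simple_gen s.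
    have yb : y b = gen i (z a) by rewrite -s1 zg.
    have ya' : y a = gen i (z b) by rewrite -{1}s2 zg.
    have [|s'] := gen_mono i zab; rewrite yb ya'; first by lia.
    have [t1 t2] := simple_gen s'.
    by move=> _; apply: nc; apply: (simple_comm s); rewrite yb ya' t1 t2.
  apply: P2; [exact: Le|exact: Le|done|].
  have [|s] := gen_mono i zab; first by rewrite !zg.
  have := simple_asc ya s; have [s1 s2] := simple_gen s.
  have e1 : y (z a) = gen i b by rewrite -s2 zg yy.
  have e2 : y (z b) = gen i a by rewrite -s1 zg yy.
  by rewrite e1 e2; lia.
move=> a x ax xz; rewrite !spM zg => q1 q2.
have aL : gen i a <: y (gen i a) by apply: L; lia.
have dich b : b <=: y b \/ y b <: b by lia.
have P1' b : b <=: y b -> v (y b) <=: v b.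
  case: (eqVneq (y b) b) => [->|ne]; first by lia.
  move: ne; rewrite eq_pt_int => /eqP ne bz.
  suff: v (y b) <: v b by lia.
  by apply: P1; lia.
(* If x is the neighbour of a, then in [y] the cycles of a and x are not nested, and [P2], with [P1]
   if a closes its cycle, contradicts [q1]. *)
have [aX|s] := gen_mono i ax; last first.
  have := simple_asc ya s; have := simple_asc va s; have [s1 s2] := simple_gen s.
  move: aL q1 q2; rewrite s1 s2 => aL q1 q2 v1 y1.
  have [d|d] := dich a.
    by have := P2 a x d; lia.
  have := P2 (y a) x; have := P1 (y a); rewrite !yy; lia.
have [|s] := gen_mono i xz; first by rewrite zg => Xz; exact: (P3 _ _ aX Xz).
have := simple_asc ya s; have := simple_asc va s; have [s1 s2] := simple_gen s.
set b := z a in s1 s2 xz q1 q2 s *.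
have yA : y (gen i a) = x by rewrite -zg.
have yx : y x = gen i a by rewrite -yA yy.
move: aX aL q1 q2; rewrite yA s1 => aX aL q1 q2 v1; rewrite yx => y1.
have [d|d] := dich b.
  by have := P2 (gen i a) b; have := P1' _ d; rewrite yA; lia.
by have := P2 (gen i a) (y b); have := P1 (y b); rewrite !yy yA; lia.
Qed.

Lemma moved_simple i x : x \in moved i -> exists a, simple i x a \/ simple i a x.
Proof.
rewrite !inE => /or4P[] /eqP->.
- by exists (hi i); left; left.
- by exists (lo i); right; left.
- by exists (neg_pt (hi i)); right; right.
by exists (neg_pt (lo i)); left; right.
Qed.

Lemma simple_moved i x a : simple i x a -> (x \in moved i) && (a \in moved i).
Proof. by case=> -[-> ->]; rewrite !inE !eqxx ?orbT. Qed.

(** The step turns fixed neighbours into a cycle, listed in the right order since [i] is an ascent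
    of [v]. No point lies between neighbours, so every other cycle is placed relative to the new one
    as it was relative to the fixed points. *)
Lemma atom_order_fix v y i : involution y -> asc y i -> asc v i ->
    gen i * y = y * gen i -> y (lo i) = lo i -> y (hi i) = hi i ->
  atom_order v y -> atom_order (v * gen i) (conj_step y i).
Proof.
move=> yV ya va c yl yh [P1 P2 P3]; set z := conj_step y i.
have zg a : z a = y (gen i a) by rewrite /z conj_stepE_comm.
have ys a b : simple i a b -> y a = a /\ y b = b.
  by case=> -[-> ->]; rewrite ?sp_neg ?yl ?yh.
have lt_s a b : simple i a b -> a <: b.
  by move=> s; have := simple_asc ya s; have [-> ->] := ys _ _ s.
have zs a b : simple i a b -> z a = b /\ z b = a.
  by move=> s; rewrite !zg; have [-> ->] := simple_gen s; have [-> ->] := ys _ _ s.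
have out a : a \notin moved i -> gen i a = a /\ z a = y a.
  by move=> ao; rewrite zg gen_out.
have outz a : a \notin moved i -> gen i (z a) = z a.
  move=> ao; have [ga za] := out a ao; rewrite za.
  have : gen i (y a) = y (gen i a) by rewrite -!spM c.
  by rewrite ga.
have mz a : a \in moved i -> a <=: z a -> simple i a (z a).
  case/moved_simple=> b [] s; have [e1 e2] := zs _ _ s; first by rewrite e1.
  by rewrite e2; have := lt_s _ _ s; lia.
have d a : a <=: z a -> (simple i a (z a)) \/ [/\ a \notin moved i, gen i a = a,
    y a = z a & gen i (z a) = z a].
  case: (boolP (a \in moved i)) => [am|ao] az; first by left; exact: mz.
  by right; have [e1 e2] := out a ao; split=> //; exact: outz.
split.
- move=> a az; rewrite !spM; have [|s|[_ -> e ->]] := d a; first by lia.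
    by have [-> ->] := simple_gen s; exact: simple_asc va s.
  by rewrite -e; apply: P1; rewrite e.
- move=> a b az bz ab zab; rewrite !spM.
  have -> : gen i (z b) = y b.
    have [s|[_ _ -> ->//]] := d b bz.
    by have [_ ->] := simple_gen s; have [-> _] := ys _ _ s.
  have ea : gen i a <=: z a /\ y (gen i a) = z a.
    have [s|[_ -> -> _]] := d a az; last by split.
    by have [-> _] := simple_gen s; have [_ ->] := ys _ _ s; split; rewrite ?lexx.
  have eb : b <=: y b /\ (y b = b \/ y b = z b).
    have [s|[_ _ -> _]] := d b bz; last by split=> //; right.
    by have [-> _] := ys _ _ s; split; [lia|left].
  have gab : gen i a <: b /\ z a <: y b.
    have [s|[ao ga ya' _]] := d a az.
      have [-> _] := simple_gen s; have le := simple_adj s ab.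
      have : z a <: b.
        apply: le_neq_lt => // e; have [_ zb] := zs _ _ s.
        by move: bz ab; rewrite -e zb; lia.
      by case: eb => _ [->|->]; lia.
    rewrite ga; split=> //; have [s|[_ _ -> _]//] := d b bz.
    have [-> _] := ys _ _ s; apply: le_neq_lt (simple_adjr s zab) _ => e.
    have := ao; rewrite -[a](@invol_inv _ z) ?e; last exact: conj_step_involution.
    by have /andP[_ ->] := simple_moved s.
  have [ea1 ea2] := ea; have [eb1 _] := eb; have [g1 g2] := gab.
  by apply: P2; rewrite ?ea2.
move=> a x ax xz; rewrite !spM.
have [|s|[ao ga ya' gz]] := d a; first by lia.
  by have := simple_adj s ax; lia.
rewrite ga gz => q1 q2.
have g1 : a <: gen i x.
  have [|s] := gen_mono i ax; first by rewrite ga.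
  by have /andP[am _] := simple_moved s; rewrite am in ao.
have g2 : gen i x <: z a.
  have [|s] := gen_mono i xz; first by rewrite gz.
  have := ao; rewrite -[a](@invol_inv _ z); last exact: conj_step_involution.
  have zm : z a \in moved i by have /andP[_] := simple_moved s.
  case/moved_simple: zm => b [] sb; have [e1 e2] := zs _ _ sb.
    by rewrite e1; have /andP[_ ->] := simple_moved sb.
  by rewrite e2; have /andP[-> _] := simple_moved sb.
by apply: (P3 a (gen i x)); rewrite ?ya'.
Qed.

(** [few_neg] passes down the chain because negated points survive each step; it leaves only
    commuting steps at fixed points. *)
Lemma chain_atom_order w z : chain_atom w z -> few_neg z -> atom_order w z.
Proof.
elim=> [|v y i vy IH ya] fz.
  by split=> [a|a b|a x]; rewrite !sp1 //; lia.
have yV := chain_atom_involution vy; have va := chain_atom_asc vy ya.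
have o := IH (few_neg_conj_step yV ya fz).
case: (gen i * y =P y * gen i) => c; last exact: atom_order_conj.
by have [yl yh] := comm_gen_few yV ya fz c; exact: atom_order_fix.
Qed.

(* Two cycles may be nested only if the outer one is {-m, m} and the inner one
   is not of this form. *)
Definition good z : Prop := forall a b, a <: b -> b <=: z b -> z b <: z a ->
  z a = neg_pt a /\ z b <> neg_pt b.

Lemma pt_sign x : exists2 m, m = x \/ m = neg_pt x & (0 < pt_int m)%R.
Proof.
have := @pt_int_neq0 n x; case: (Order.TotalTheory.ltgtP (pt_int x) 0%R) => // x0 _.
  by exists (neg_pt x); [right|rewrite pt_int_neg; lia].
by exists x; [left|].
Qed.

Lemma negated_neg z x : z x = neg_pt x -> z (neg_pt x) = x.
Proof. by rewrite sp_neg => ->; rewrite neg_ptK. Qed.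

Lemma good_few_neg z : good z -> few_neg z.
Proof.
have lt_nested x a : good z -> z x = neg_pt x -> z a = neg_pt a ->
    (0 < pt_int x)%R -> (0 < pt_int a)%R -> x <: a -> False.
  move=> g zx za x0 a0 xa.
  have := g (neg_pt a) (neg_pt x); rewrite !(negated_neg zx) !(negated_neg za).
  by rewrite !pt_int_neg !neg_ptK => -[]; lia || auto.
move=> g x a zx za.
have neg_or (y m : pt n) : z y = neg_pt y -> m = y \/ m = neg_pt y -> z m = neg_pt m.
  by move=> zy [] -> //; rewrite neg_ptK negated_neg.
have [m mx m0] := pt_sign x; have [k ka k0] := pt_sign a.
have zm := neg_or _ _ zx mx; have zk := neg_or _ _ za ka.
have e : m = k.
  apply: pt_int_inj; case: (Order.TotalTheory.ltgtP (pt_int m) (pt_int k)) => // l.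
    by case: (lt_nested m k).
  by case: (lt_nested k m).
move: e; case: mx => ->; case: ka => ->.
- by move=> ->; left.
- by move=> ->; right; rewrite neg_ptK.
- by move=> <-; right.
by move/(can_inj (@neg_ptK n))=> ->; left.
Qed.

End Order.

(** * Uniqueness of the atom of a good involution *)

Section Unique.
Local Open Scope group_scope.
Variable n : nat.
Implicit Types (u v w : signed_perm n) (i : 'I_n) (x y a b m : pt n).
Variable z : signed_perm n.
Hypotheses (zV : involution z) (zg : good z).

Lemma cycle_opener x : exists a, [/\ a <=: z a, x = a \/ x = z a &
  forall w, atom_order w z -> w (z a) <=: w x /\ w x <=: w a].
Proof.
have H a : a <=: z a -> forall w, atom_order w z -> w (z a) <=: w a.
  move=> az w [P1 _ _]; case: (eqVneq (z a) a) => [->|ne]; first by lia.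
  have : a <: z a by apply: le_neq_lt => // e; move: ne; rewrite -e eqxx.
  by move/P1; lia.
case: (Order.TotalTheory.leP (pt_int x) (pt_int (z x))) => xz.
  by exists x; split; [|left|move=> w /(H _ xz); lia].
have xz' : z x <=: z (z x) by rewrite invol_inv //; lia.
exists (z x); split; [by []|by right; rewrite invol_inv|] => w /(H _ xz').
by rewrite invol_inv //; lia.
Qed.

Lemma negated_cycle x : z x = neg_pt x -> z (z x) = neg_pt (z x).
Proof. by move=> zx; rewrite zx negated_neg // neg_ptK. Qed.

Definition forced x y : Prop := forall w, atom_order w z -> w x <: w y.

Lemma forced_nonneg x y : x <> y -> z x <> neg_pt x -> z y <> neg_pt y ->
  forced x y \/ forced y x.
Proof.
move=> xy nx ny; have [a [az xa wa]] := cycle_opener x.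
have [b [bz yb wb]] := cycle_opener y.
have na : z a <> neg_pt a by case: xa nx => -> // h /negated_cycle.
have nb : z b <> neg_pt b by case: yb ny => -> // h /negated_cycle.
have [E|ab] := eqVneq a b.
  have nab : z a <> a by case: xa yb xy => -> [] ->; rewrite E // => ? ?; auto.
  have lt : a <: z a by apply: le_neq_lt => // /esym.
  case: xa yb xy => -> [] ->; rewrite -?E // => _.
    by right=> w [P1 _ _]; exact: P1.
  by left=> w [P1 _ _]; exact: P1.
have H c d : c <=: z c -> d <=: z d -> z c <> neg_pt c -> c <: d -> c <> d ->
    forall w, atom_order w z -> w c <: w (z d).
  move=> cz dz nc cd ne w [_ P2 _]; apply: P2 => //.
  case: (Order.TotalTheory.ltgtP (pt_int (z c)) (pt_int (z d))) => // [l|/pt_int_inj/perm_inj//].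
  by case: (zg cd dz l).
move/eqP: ab => ab.
case: (Order.TotalTheory.ltgtP (pt_int a) (pt_int b)) => [l|l|/pt_int_inj//].
  by left=> w wo; have := H _ _ az bz na l ab w wo; have := wa w wo; have := wb w wo; lia.
by right=> w wo; have := H _ _ bz az nb l (not_eq_sym ab) w wo;
  have := wa w wo; have := wb w wo; lia.
Qed.

(** A cycle inside {-m, m} is kept out of the gap between w(m) and w(-m) by the third condition, a
    cycle overlapping or beside {-m, m} by the second, and goodness excludes a cycle around it. So
    these two values sit in the middle. *)
Lemma negated_center w m x : atom_order w z -> z m = neg_pt m -> z x <> neg_pt x ->
  (0 < pt_int m)%R ->
  (pt_int (w m) < 0)%R /\ (w x <: w m \/ w (neg_pt m) <: w x).
Proof.
move=> wo zm nx m0; have [P1 P2 P3] := wo.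
have zm' := negated_neg zm.
have wm : w m <: w (neg_pt m).
  by have := P1 (neg_pt m); rewrite zm' pt_int_neg => -> //; lia.
split; first by move: wm; rewrite sp_neg pt_int_neg; lia.
have [a [az xa wx]] := cycle_opener x; have {}wx := wx w wo.
have na : z a <> neg_pt a by case: xa nx => -> // h /negated_cycle.
have am : a <> m by move=> e; rewrite e in na.
have am' : a <> neg_pt m by move=> e; apply: na; rewrite e neg_ptK.
have zam : z a <> m by move=> e; apply: am'; rewrite -zm -e invol_inv.
have am2 : pt_int a <> (- pt_int m)%R by rewrite -pt_int_neg => /pt_int_inj.
have am1 : pt_int a <> pt_int m by move/pt_int_inj.
have am3 : pt_int (z a) <> pt_int m by move/pt_int_inj.
have e0 := pt_int_neg m.
case: (Order.TotalTheory.ltgtP (pt_int a) (- pt_int m)%R) => // l1;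
  case: (Order.TotalTheory.ltgtP (pt_int (z a)) (pt_int m)) => // l2.
- left; have := P2 a (neg_pt m); rewrite zm' e0; lia.
- by have := zg (a := a) (b := neg_pt m); rewrite zm' e0 => -[]; lia || auto.
- have xn : w x <> w m by move/perm_inj=> e; move: nx; rewrite e.
  have xn' : w x <> w (neg_pt m) by move/perm_inj=> e; move: nx; rewrite e neg_ptK.
  have := P3 (neg_pt m) x; rewrite zm' e0.
  have : (- pt_int m < pt_int x)%R by case: xa => ->; lia.
  have : x <: m by case: xa => ->; lia.
  have i1 : pt_int (w x) <> pt_int (w m) by move/pt_int_inj.
  have i2 : pt_int (w x) <> pt_int (w (neg_pt m)) by move/pt_int_inj.
  by lia.
right; have := P2 (neg_pt m) a; rewrite zm' e0; lia.
Qed.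

Lemma forced_total x y : x <> y -> forced x y \/ forced y x.
Proof.
have H m (u : pt n) : z m = neg_pt m -> z u <> neg_pt u -> forced m u \/ forced u m.
  move=> zm nu; have nu' : z (neg_pt u) <> neg_pt (neg_pt u).
    by move=> e; apply: nu; have := negated_neg e; rewrite !neg_ptK.
  have key w : atom_order w z ->
      (pt_int (w u) < 0 -> w u <: w m)%R /\ (0 < pt_int (w u) -> w m <: w u)%R.
    move=> wo; have [k km k0] := pt_sign m.
    have zk : z k = neg_pt k by case: km => -> //; rewrite neg_ptK negated_neg.
    have [w0 wc] := negated_center wo zk nu k0.
    have wm : pt_int (w m) = pt_int (w k) \/ pt_int (w m) = (- pt_int (w k))%R.
      by case: km => ->; [left|right; rewrite sp_neg pt_int_neg; lia].
    by move: wc; rewrite sp_neg pt_int_neg; lia.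
  (* The order of u and -u is forced and determines the sign of w(u), which decides the side of the
     central pair on which w(u) lies. *)
  have [f|f] := @forced_nonneg u (neg_pt u) (fun e => neg_pt_neq (esym e)) nu nu'.
    right=> w wo; have := f w wo; have [+ _] := key w wo.
    by rewrite sp_neg pt_int_neg; lia.
  left=> w wo; have := f w wo; have [_ +] := key w wo.
  by rewrite sp_neg pt_int_neg; lia.
move=> xy; case: (eqVneq (z x) (neg_pt x)) (eqVneq (z y) (neg_pt y)) => [zx|/eqP nx] [zy|/eqP ny].
- have [|->] := good_few_neg zg zx zy; first by move/esym.
  have := pt_int_neg x; have := @pt_int_neq0 n x.
  case: (Order.TotalTheory.ltgtP (pt_int x) 0%R) => // x0 _ e.
    by right=> w [P1 _ _]; have := P1 x; rewrite zx; apply; lia.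
  by left=> w [P1 _ _]; have := P1 (neg_pt x); rewrite negated_neg //; apply; lia.
- exact: H.
- by case: (H y x zy nx); [right|left].
exact: forced_nonneg.
Qed.

(** Both elements order the points in the same way, so w' w^-1 has no descent. *)
Lemma good_unique w w' : atom_order w z -> atom_order w' z -> w = w'.
Proof.
move=> wo wo'.
suff : w' * w^-1 = 1 by move/(canRL (mulgKV _)); rewrite mul1g => ->.
apply: all_asc => i; rewrite /asc !spM.
have ww x : w (w^-1 x) = x by rewrite -spM mulgV sp1.
set x := w^-1 (lo i); set y := w^-1 (hi i).
have xy : w x <: w y by rewrite /x /y !ww; have := lo_hi_int i; rewrite /=; lia.
have [|f|f] := @forced_total x y; last 2 first.
- exact: f.
- by have := f w wo; lia.
by move=> e; move: xy; rewrite e; lia.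
Qed.
End Unique.

(** * Involutions with a single atom *)

Section Single.
Local Open Scope group_scope.
Variable n : nat.
Implicit Types (u v w y z : signed_perm n) (i j : 'I_n) (x a b c : pt n).

Definition single_atom z : Prop :=
  forall w w', chain_atom w z -> chain_atom w' z -> w = w'.

Lemma single_atom_conj_step z i : single_atom z -> ~~ asc z i ->
  single_atom (conj_step z i).
Proof.
move=> sz di v v' vy vy'; have a := asc_conj_step_desc di.
by apply: (mulIg (gen i)); apply: sz; rewrite -[z](conj_stepK di); apply: chain_atom_step.
Qed.

(** Appending [gen i] to an atom of [conj_step z i] gives an atom of z with descent [i], and there
    is only one atom. *)
Lemma single_atom_desc w z i : involution z -> single_atom z -> chain_atom w z ->
  ~~ asc z i -> ~~ asc w i.
Proof.
move=> zV sz wz di; have a := asc_conj_step_desc di.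
have [v vy] := chain_atom_exists (conj_step_involution i zV).
rewrite (sz _ (v * gen i) wz); first by rewrite asc_mul_gen negbK (chain_atom_asc vy a).
by rewrite -[z](conj_stepK di); apply: chain_atom_step.
Qed.

Lemma comm_of_mul z i : gen i * (z * gen i) = z * gen i * gen i ->
  gen i * z = z * gen i.
Proof. by rewrite mulgA => /mulIg. Qed.

Lemma comm_gen_desc z i : involution z -> ~~ asc z i -> gen i * z = z * gen i ->
  (z (lo i) = hi i /\ z (hi i) = lo i) \/
  [/\ i != 0 :> nat, z (lo i) = neg_pt (lo i) & z (hi i) = neg_pt (hi i)].
Proof.
move=> zV di c; have e : conj_step z i = z * gen i by rewrite /conj_step c eqxx.
have c' : gen i * conj_step z i = conj_step z i * gen i by rewrite e mulgA c.
have := comm_gen (conj_step_involution i zV) (asc_conj_step_desc di) c'.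
by rewrite e !spM gen_lo gen_hi => -[[-> ->]|[i0 -> ->]]; [left|right].
Qed.

(** Going down at [i] moves the cycle of x along with [gen i], unless that cycle is itself a simple
    pair, which dissolves into fixed points, or two neighbouring negated points merge into other
    cycles. *)
Lemma conj_step_transport z i x : involution z -> ~~ asc z i ->
  [\/ conj_step z i (gen i x) = gen i (z x), simple i x (z x), simple i (z x) x |
   i != 0 :> nat /\ z (lo i) = neg_pt (lo i) /\ z (hi i) = neg_pt (hi i)].
Proof.
move=> zV di; case: (gen i * z =P z * gen i) => c; last first.
  by constructor 1; rewrite conj_stepE_conj // genK.
have [[zl zh]|[i0 zl zh]] := comm_gen_desc zV di c; last by constructor 4.
case: (boolP (x \in moved i)) => [|xo]; last first.
  constructor 1; rewrite conj_stepE_comm // genK.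
  by rewrite -[RHS]spM c spM (gen_out xo).
rewrite !inE => /or4P[] /eqP->; rewrite ?sp_neg ?zl ?zh.
- by constructor 2; left.
- by constructor 3; left.
- by constructor 3; right.
by constructor 2; right.
Qed.

Definition nested z a b := [/\ a <: b, b <=: z b & z b <: z a].

Lemma simple2 i a b c x : simple i a c -> simple i b x ->
  (b = a /\ x = c) \/ (b = neg_pt c /\ x = neg_pt a).
Proof.
by case=> -[-> ->] [] [-> ->]; rewrite ?neg_ptK; auto.
Qed.

Lemma simple_neg i a b : simple i a b -> simple i (neg_pt b) (neg_pt a).
Proof. by case=> -[-> ->]; rewrite ?neg_ptK; [right|left]. Qed.

Lemma simple_lt i x a : simple i x a -> x <: a.
Proof.
by have := lo_hi_int i => /= lh; case=> -[-> ->]; rewrite ?pt_int_neg; lia.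
Qed.

Lemma simple_desc z i x a : simple i x a -> z a <: z x -> ~~ asc z i.
Proof. by move=> s l; apply/negP => /simple_asc/(_ s); lia. Qed.

Lemma succ_pt a b : a <: b -> exists i c, simple i a c.
Proof.
case: a => [[] [k kn]]; last first.
  case: b => [[] [j jn]]; rewrite /pt_int /=; first by lia.
  move=> kj; have kn1 : k.+1 < n by lia.
  exists (Ordinal kn1), (hi (Ordinal kn1)); left; split=> //.
  by apply: pt_int_inj; rewrite pt_int_lo /pt_int /=.
case: k kn => [|k] kn _.
  exists (Ordinal kn), (hi (Ordinal kn)); left; split=> //.
exists (Ordinal kn), (neg_pt (lo (Ordinal kn))); right; split=> //.
Qed.

(** * Forbidden nestings contradict the uniqueness of the atom *)

Section Descend.
Variable z : signed_perm n.
Hypotheses (zV : involution z) (zS : single_atom z).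
Hypothesis IH : forall i, ~~ asc z i -> good (conj_step z i).

(** At any other descent both negated pairs would survive in [conj_step z i], which is good and
    hence has at most one. *)
Lemma two_negated_desc x a i : z x = neg_pt x -> z a = neg_pt a ->
    a <> x -> a <> neg_pt x -> ~~ asc z i ->
  z (lo i) = neg_pt (lo i) /\ z (hi i) = neg_pt (hi i).
Proof.
move=> zx za ax anx di; have fy := good_few_neg (IH di).
have W b : simple i b (neg_pt b) -> z b = neg_pt b ->
    z (lo i) = neg_pt (lo i) /\ z (hi i) = neg_pt (hi i).
  move=> s zb; have zb' := negated_neg zb.
  case: s => -[eb en]; first by rewrite -eb -en zb neg_ptK.
  have eh : hi i = neg_pt b by rewrite eb neg_ptK.
  have el : lo i = b by apply: (can_inj (@neg_ptK n)).
  by rewrite eh el zb neg_ptK.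
have T b : z b = neg_pt b ->
    conj_step z i (gen i b) = neg_pt (gen i b) \/
    (z (lo i) = neg_pt (lo i) /\ z (hi i) = neg_pt (hi i)).
  move=> zb; have [e|s|s|[_ [? ?]]] := conj_step_transport b zV di; last by right.
  - by left; rewrite e zb gen_neg.
  - by right; apply: (W b) => //; rewrite -zb.
  - right; apply: (W (neg_pt b)); rewrite neg_ptK ?negated_neg //.
    by rewrite -zb.
have [gx|//] := T _ zx; have [ga|//] := T _ za.
have [] := fy _ _ gx ga.
  by move/perm_inj.
by rewrite -gen_neg => /perm_inj.
Qed.

Definition ord_pt (k : nat) (kn : k < n) : pt n := pos (Ordinal kn).

(** Along 1, ..., n, z decreases only at neighbouring negated points. If z(1) > 0, no value ever
    becomes negative; if z(1) = -1 and t_1 is an ascent, no value falls below -1, so only 1 would be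
    negated. *)
Lemma two_negated_small x a : z x = neg_pt x -> z a = neg_pt a ->
    a <> x -> a <> neg_pt x -> exists (n0 : 0 < n) (n1 : 1 < n),
  z (ord_pt n0) = neg_pt (ord_pt n0) /\ z (ord_pt n1) = neg_pt (ord_pt n1).
Proof.
move=> zx za ax anx; have D i := two_negated_desc zx za ax anx (i := i).
have n0 : 0 < n by have := ltn_ord x.2; lia.
have loS k (kn : k.+1 < n) (kn' : k < n) : lo (Ordinal kn) = ord_pt kn'.
  by apply: pt_int_inj; rewrite pt_int_lo /pt_int /=.
have [m mx m0] := pt_sign x; have [l la l0] := pt_sign a.
have neg_or b c : z b = neg_pt b -> c = b \/ c = neg_pt b -> z c = neg_pt c.
  by move=> zb [] -> //; rewrite neg_ptK negated_neg.
have zm := neg_or _ _ zx mx; have zl := neg_or _ _ za la.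
have ml : m <> l.
  move=> e; move: mx la; rewrite e => -[->|->] [e'|e'].
  - exact: ax.
  - by apply: anx; rewrite e' neg_ptK.
  - by apply: anx; rewrite e'.
  by apply: ax; apply: (can_inj (@neg_ptK n)).
have posE b : (0 < pt_int b)%R -> exists k (kn : k < n), b = ord_pt kn.
  by case: b => [[] [k kn]]; rewrite /pt_int //= => _; exists k, kn.
have z0 : z (ord_pt n0) = neg_pt (ord_pt n0).
  case: (boolP (asc z (Ordinal n0))) => [a0|/D[]//]; exfalso.
  have pz k (kn : k < n) : (0 < pt_int (z (ord_pt kn)))%R.
    elim: k kn => [|k IHk] kn.
      move: a0; rewrite /asc (lo0 (i := Ordinal n0)) // sp_neg pt_int_neg.
      rewrite (_ : hi _ = ord_pt kn); first by lia.
      by congr (_, _); apply: val_inj.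
    have kn' := ltnW kn; have := IHk kn'.
    case: (boolP (asc z (Ordinal kn))) => [|/D[]]; rewrite /asc (loS _ _ kn').
      by rewrite -[hi _]/(ord_pt kn); lia.
    by move=> ->; rewrite pt_int_neg /pt_int /=; lia.
  have [k [kn km]] := posE _ m0; have := pz k kn.
  by rewrite -km zm pt_int_neg; lia.
have n1 : 1 < n.
  have [k [kn km]] := posE _ m0; have [k' [kn' kl]] := posE _ l0.
  have [k0|] := eqVneq k 0%N; last by lia.
  have [k0'|] := eqVneq k' 0%N; last by lia.
  case: ml; rewrite km kl; congr (_, _); apply: val_inj; rewrite /=; lia.
exists n0, n1; split=> //.
case: (boolP (asc z (Ordinal n1))) => [a1|/D[]//]; exfalso.
have pz k (kn : k < n) : (-1 <= pt_int (z (ord_pt kn)))%R.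
  elim: k kn => [|k IHk] kn.
    have -> : ord_pt kn = ord_pt n0 by congr (_, _); apply: val_inj.
    by rewrite z0 pt_int_neg /pt_int /=; lia.
  have kn' := ltnW kn; have := IHk kn'.
  case: (boolP (asc z (Ordinal kn))) => [|d].
    by rewrite /asc (loS _ _ kn') -[hi _]/(ord_pt kn); lia.
  have [+ _] := D _ d; rewrite (loS _ _ kn') => -> le.
  case: k {IHk} kn kn' d le => [|k] kn kn' d; last by rewrite pt_int_neg /pt_int /=; lia.
  by move=> _; case/negP: d; rewrite (_ : Ordinal kn = Ordinal n1) //; apply: val_inj.
have K b : (0 < pt_int b)%R -> z b = neg_pt b -> b = ord_pt n0.
  move=> /posE[k [kn ->]] e; have := pz k kn; rewrite e pt_int_neg /pt_int /= => k1.
  by congr (_, _); apply: val_inj => /=; lia.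
by apply: ml; rewrite (K m) // (K l).
Qed.

(* t_1, t_0, t_1 lead from z down to an involution with the ascent t_0, so the
   atoms of z ending with t_1 t_0 t_1 do not have the descent t_0 of z. *)
Lemma one_two_not_negated (n0 : 0 < n) (n1 : 1 < n) :
  z (ord_pt n0) = neg_pt (ord_pt n0) -> z (ord_pt n1) = neg_pt (ord_pt n1) -> False.
Proof.
set p0 := ord_pt n0; set p1 := ord_pt n1 => z0 z1.
pose i0 := Ordinal n0; pose i1 := Ordinal n1.
have h0 : hi i0 = p0 by []. have h1 : hi i1 = p1 by [].
have l0 : lo i0 = neg_pt p0 by rewrite (lo0 (i := i0)).
have l1 : lo i1 = p0 by apply: pt_int_inj; rewrite pt_int_lo /pt_int /=.
have I0 : pt_int p0 = 1%R by []. have I1 : pt_int p1 = 2%R by [].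
have g0 : gen i0 p0 = neg_pt p0 by rewrite -h0 gen_hi l0.
have g01 : gen i0 p1 = p1.
  apply: gen_out; rewrite !inE l0 h0 !neg_ptK !eq_pt_int !pt_int_neg I0 I1.
  by [].
have g10 : gen i1 p0 = p1 by rewrite -l1 gen_lo.
have g11 : gen i1 p1 = p0 by rewrite -h1 gen_hi.
have d1 : ~~ asc z i1 by rewrite /asc l1 h1 z0 z1 !pt_int_neg I0 I1.
have d0 : ~~ asc z i0 by rewrite /asc l0 h0 sp_neg z0 !pt_int_neg I0.
have Cm u : u p0 = neg_pt p0 /\ u p1 = neg_pt p1 \/ u p0 = p1 /\ u p1 = p0 ->
    gen i1 * u = u * gen i1.
  move=> H; apply: comm_of_mul; apply: gen_conj.
  rewrite !spM gen_lo gen_hi l1 h1.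
  by case: H => -[-> ->]; [right|left].
pose y1 := conj_step z i1; have y1E x : y1 x = z (gen i1 x).
  by rewrite /y1 conj_stepE_comm //; apply: Cm; left.
have y10 : y1 p0 = neg_pt p1 by rewrite y1E g10.
have y11 : y1 p1 = neg_pt p0 by rewrite y1E g11.
have e1 : ~~ asc y1 i0 by rewrite /asc l0 h0 sp_neg y10 !pt_int_neg I1.
pose y2 := conj_step y1 i0; have y2E x : y2 x = gen i0 (y1 (gen i0 x)).
  rewrite /y2 conj_stepE_conj // => /(congr1 (fun u : signed_perm n => pt_int (u p0))).
  by rewrite !spM g0 !sp_neg y10 gen_neg g01 neg_ptK pt_int_neg I1.
have y20 : y2 p0 = p1 by rewrite y2E g0 sp_neg y10 neg_ptK.
have y21 : y2 p1 = p0 by rewrite y2E g01 y11 gen_neg g0 neg_ptK.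
have e2 : ~~ asc y2 i1 by rewrite /asc l1 h1 y20 y21 I1 I0.
pose y3 := conj_step y2 i1; have y3E x : y3 x = y2 (gen i1 x).
  by rewrite /y3 conj_stepE_comm //; apply: Cm; right.
have y30 : y3 p0 = p0 by rewrite y3E g10.
have y1V := conj_step_involution i1 zV; have y2V := conj_step_involution i0 y1V.
have a0 : asc y3 i0 by rewrite /asc l0 h0 sp_neg y30 pt_int_neg I0.
have [v vy] := chain_atom_exists (conj_step_involution i1 y2V).
have v0 := chain_atom_asc vy a0.
have w2 := chain_atom_step vy (asc_conj_step_desc e2); rewrite (conj_stepK e2) in w2.
have w1 := chain_atom_step w2 (asc_conj_step_desc e1); rewrite (conj_stepK e1) in w1.
have w0 := chain_atom_step w1 (asc_conj_step_desc d1); rewrite (conj_stepK d1) in w0.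
have := single_atom_desc zV zS w0 d0; rewrite /asc l0 h0 !spM !gen_neg.
rewrite g10 g01 g11 sp_neg pt_int_neg.
by move: v0; rewrite /asc l0 h0 sp_neg pt_int_neg; lia.
Qed.

Lemma single_few_neg : few_neg z.
Proof.
move=> x a zx za; have [->|/eqP ax] := eqVneq a x; first by left.
have [->|/eqP anx] := eqVneq a (neg_pt x); first by right.
have [n0 [n1 [z0 z1]]] := two_negated_small zx za ax anx.
by case: (one_two_not_negated z0 z1).
Qed.

Lemma conj_step_transport_few i x : ~~ asc z i ->
  [\/ conj_step z i (gen i x) = gen i (z x), simple i x (z x) | simple i (z x) x].
Proof.
move=> di; have [|||[i0 [zl zh]]] := conj_step_transport x zV di; [by constructor 1|..].
- by constructor 2.
- by constructor 3.
have [e|e] := single_few_neg zl zh.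
  by have := lo_hiN i; rewrite e eqxx.
by have := lo_neq_neghi i0; rewrite e neg_ptK eqxx.
Qed.

(** Otherwise [gen i] keeps the order of the four end points and carries the nesting to the good
    involution [conj_step z i], with an outer cycle that is still not symmetric. *)
Lemma push_nested i a b : ~~ asc z i -> nested z a b -> z a <> neg_pt a ->
  [\/ simple i a b, simple i b (z b) | simple i (z b) (z a)].
Proof.
move=> di [ab bz zba] na.
have [sab|s|s] := conj_step_transport_few a di; last 2 first.
- by have := simple_adj s ab; lia.
- by have := simple_lt s; lia.
have [sb|s|s] := conj_step_transport_few b di; last 2 first.
- by constructor 2.
- by have := simple_lt s; lia.
have [g1|] := gen_mono i ab; last by constructor 1.
have g2 : gen i b <=: gen i (z b) \/ simple i b (z b).
  have [->|/eqP ne] := eqVneq (z b) b; first by left; lia.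
  have /gen_mono : b <: z b by apply: le_neq_lt => // /esym.
  by move/(_ i)=> [?|?]; [left; lia|right].
case: g2 => [g2|]; last by constructor 2.
have [g3|] := gen_mono i zba; last by constructor 3.
have := IH di (a := gen i a) (b := gen i b); rewrite sab sb => /(_ g1 g2 g3) [].
by rewrite -gen_neg => /perm_inj.
Qed.

Lemma exists_desc_le k (kn : k < n) : (pt_int (z (ord_pt kn)) < 0)%R ->
  exists i : 'I_n, i <= k /\ ~~ asc z i.
Proof.
move=> zk; have [|/existsPn H] := boolP [exists i : 'I_n, (i <= k) && ~~ asc z i].
  by case/existsP=> i /andP[? ?]; exists i.
suff: (0 < pt_int (z (ord_pt kn)))%R by lia.
elim: k kn H {zk} => [|k IHk] kn H.
  have := H (Ordinal kn); rewrite /= negbK /asc lo0 // sp_neg pt_int_neg.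
  by rewrite -[hi _]/(ord_pt kn); lia.
have kn' := ltnW kn; have : (0 < pt_int (z (ord_pt kn')))%R.
  apply: IHk => i; have := H i; rewrite !negb_and !negbK.
  by case/orP=> [|->]; [move=> ?; apply/orP; left; lia|rewrite orbT].
have := H (Ordinal kn); rewrite /= leqnn negbK /asc.
have -> : lo (Ordinal kn) = ord_pt kn'.
  by apply: pt_int_inj; rewrite pt_int_lo /pt_int /=.
by rewrite -[hi _]/(ord_pt kn); lia.
Qed.

Lemma gen_small i x k : i <= k -> (- (k.+1)%:Z <= pt_int x <= (k.+1)%:Z)%R ->
  (- (k.+1)%:Z <= pt_int (gen i x) <= (k.+1)%:Z)%R.
Proof.
move=> ik; have := gen_int i x; have := lo_hi_int i; rewrite /= [pt_int (hi i)]pt_int_hi.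
move: (pt_int _) (pt_int _) (pt_int _) => l p q.
by case=> -[? ?]; case=> [[? ?]|[? ?]|[[? ?]|[? ?]|[? ? ? ? ?]]]; lia.
Qed.

Lemma gen_large i x k : i <= k -> ((k.+1)%:Z < pt_int x \/ pt_int x < - (k.+1)%:Z)%R ->
  gen i x = x.
Proof.
move=> ik H; apply: pt_int_inj; move: H.
have := gen_int i x; have := lo_hi_int i; rewrite /= [pt_int (hi i)]pt_int_hi.
move: (pt_int (lo i)) (pt_int x) (pt_int _) => l p q.
by case=> -[? ?]; case=> [[? ?]|[? ?]|[[? ?]|[? ?]|[? ? ? ? ?]]]; lia.
Qed.

(** With m = -b, the value z(m) = -m < 0 yields a descent among the generators acting on [-m, m]
    only. It leaves a and z(a) alone and keeps a negated or fixed point inside their cycle, so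
    [conj_step z i] is not good. *)
Lemma no_negated_inside a b : nested z a b -> z a <> neg_pt a ->
  z b = neg_pt b -> False.
Proof.
move=> [ab bz zba] na zb.
have [m0 e0] : (pt_int b < 0)%R /\ pt_int (z b) = (- pt_int b)%R.
  by move: bz; rewrite zb pt_int_neg; have := @pt_int_neq0 n b; lia.
have [k [kn kb]] : exists k (kn : k < n), neg_pt b = ord_pt kn.
  case: b m0 {ab bz zba zb e0} => [[] [k kn]]; rewrite /pt_int //= => _.
  by exists k, kn.
have bk : pt_int b = (- (k.+1)%:Z)%R.
  by rewrite -[b]neg_ptK kb pt_int_neg.
have [|i [ik di]] := @exists_desc_le k kn.
  by rewrite -kb (negated_neg zb); lia.
have ga : gen i a = a by apply: (gen_large ik); lia.
have gza : gen i (z a) = z a by apply: (gen_large ik); lia.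
have sa : conj_step z i a = z a.
  have [|s|s] := conj_step_transport_few a di; first by rewrite ga gza.
    by have := simple_adj s ab; lia.
  by have := simple_lt s; lia.
have gb := gen_small ik (x := b).
have gb' : pt_int (gen i b) <> 0%R by exact: pt_int_neq0.
have [sb|s|s] := conj_step_transport_few b di; last 2 first.
- (* t_0 turns -1, 1 into fixed points, still inside the cycle of a *)
  have eb : conj_step z i b = b.
    have bm : gen i (z b) = b by have [] := simple_gen s.
    have c : gen i * z = z * gen i.
      apply: comm_of_mul; apply: gen_conj; rewrite !spM gen_lo gen_hi.
      left; case: s => -[eb1 eb2]; first by rewrite -eb1 -eb2 invol_inv.
      have zh : z (hi i) = lo i.
        by apply: (can_inj (@neg_ptK n)); rewrite -sp_neg -eb1.
      by rewrite zh -zh invol_inv.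
    by rewrite conj_stepE_comm // -[in LHS]bm genK invol_inv.
  have := IH di (a := a) (b := b); rewrite sa eb => /(_ ab).
  by case=> //; lia.
- by have := simple_lt s; lia.
have sb' : conj_step z i (gen i b) = neg_pt (gen i b) by rewrite sb zb gen_neg.
case: (Order.TotalTheory.ltgtP (pt_int (gen i b)) 0%R) => // g0.
  have := IH di (a := a) (b := gen i b); rewrite sa sb' pt_int_neg.
  by case=> //; lia.
have := IH di (a := a) (b := neg_pt (gen i b)).
by rewrite sa (negated_neg sb') pt_int_neg; case=> //; lia.
Qed.

Lemma nested_neighbours a b : nested z a b -> z a <> neg_pt a ->
  exists i, simple i a b.
Proof.
move=> N na; have nb : z b <> neg_pt b by move/(no_negated_inside N na).
have [ab bz zba] := N.
(* c is the last point before b whose partner lies beyond z(b). By maximality z descends from c to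
   its successor x, and going down there can only destroy the nesting of b in c if x = b, unless c
   is negated. *)
pose P := [pred c | [&& pt_int c < pt_int b & pt_int (z b) < pt_int (z c)]%R].
have Pa : P a by rewrite inE ab zba.
have [c [cb zbc] cmax] : exists2 c, c <: b /\ z b <: z c &
    forall x, x <: b -> z b <: z x -> x <=: c.
  case: (@Order.TotalTheory.arg_maxP _ _ _ a P (fun c => pt_int c) Pa) => c.
  by rewrite inE => /andP[? ?] H; exists c => // x ? ?; apply: H; rewrite inE; apply/andP.
have [i [x s]] := succ_pt cb; have cx := simple_lt s; have xb := simple_adj s cb.
have di : ~~ asc z i.
  apply: (simple_desc s); have [->|/eqP ne] := eqVneq x b; first by [].
  have {}xb : x <: b by apply: le_neq_lt.
  have := cmax x xb; case: (Order.TotalTheory.ltgtP (pt_int (z x)) (pt_int (z c))) => //.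
    by lia.
  by move/pt_int_inj/perm_inj=> e; move: cx; rewrite e; lia.
have [s1 s2] := simple_gen s.
have zx_c : z x <> c.
  move=> e; have e' : z c = x by rewrite -e invol_inv.
  by move: zbc; rewrite e'; lia.
have nsb : ~ simple i b (z b).
  move/(simple2 s) => [[e _]|[e e']]; first by move: cb; rewrite e; lia.
  by apply: zx_c; apply: (can_inj (@neg_ptK n)); rewrite -sp_neg -e.
have bc : b <> c by move=> e; move: cb; rewrite e; lia.
have zbc' : z b <> c by move=> e; move: bz cb; rewrite e; lia.
have push_c : z c <> neg_pt c -> x = b.
  have N' : nested z c b by [].
  move=> nc; have [||] := push_nested di N' nc.
  - by move/simple_gen=> [e _]; rewrite -s1 e.
  - by move/nsb.
  by move/(simple2 s) => [[e _]|[_ e]]; [case: zbc'|case: nc].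
have [E|/eqP ac] := eqVneq a c.
  have nc : z c <> neg_pt c by rewrite -E.
  by exists i; rewrite E -(push_c nc).
exfalso; have lac : a <: c by apply: le_neq_lt => //; exact: cmax.
(* If a < c, the one way left to destroy the nesting in a is z(a) = -c, z(b) = -x. Then c is not
   negated, hence x = b, and b would be negated. *)
have [||] := push_nested di N na; last 1 first.
- move/(simple2 s) => [[e _]|[e e']]; first by case: zbc'.
  have zc : z c = neg_pt a.
    by apply: (can_inj (@neg_ptK n)); rewrite -sp_neg -e' invol_inv ?neg_ptK.
  apply: nb; rewrite e push_c // => e2; apply: ac; apply: (@perm_inj _ z).
  by rewrite e' e2.
- by move=> s'; have := simple_adj s' lac; lia.
by move/nsb.
Qed.

Lemma single_good : good z.
Proof.
move=> a b ab bz zba; have N : nested z a b by [].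
have [za|/eqP na] := eqVneq (z a) (neg_pt a).
  split=> // zb; have [e|e] := single_few_neg za zb.
    by move: ab; rewrite e; lia.
  by move: ab bz zba; rewrite zb za e neg_ptK pt_int_neg; lia.
exfalso; have [i sab] := nested_neighbours N na.
(* The mirror image of the nesting shows that the closing ends z(b), z(a) are neighbours too. The
   descents of z at both ends pass to w and give w(z a) < w(z b) <= w(b) < w(a), contrary to
   [P3]. *)
have N' : nested z (neg_pt (z a)) (neg_pt (z b)).
  by split; rewrite ?sp_neg ?invol_inv // !pt_int_neg; lia.
have [|j sba] := nested_neighbours N'.
  rewrite sp_neg invol_inv // neg_ptK => e; apply: na.
  by rewrite -[z a]e.
have {}sba : simple j (z b) (z a) by rewrite -[z b]neg_ptK -[z a]neg_ptK; apply: simple_neg.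
have [w wz] := chain_atom_exists zV.
have [P1 _ P3] := chain_atom_order wz single_few_neg.
have K k (x y : pt n) : simple k x y -> z y <: z x -> w y <: w x.
  move=> s l; have dw := single_atom_desc zV zS wz (simple_desc s l).
  have : ~ w x <: w y.
    move=> l'; case/negP: dw; rewrite /asc.
    by case: s l' => -[-> ->]; rewrite ?sp_neg ?pt_int_neg; lia.
  have : w x <> w y by move/perm_inj=> e; move: l; rewrite e; lia.
  by move=> ne nl; apply: le_neq_lt; [lia|exact/not_eq_sym].
have k1 := K _ _ _ sab zba.
have k2 : w (z a) <: w (z b) by apply: (K _ _ _ sba); rewrite !invol_inv.
have zab : b <: z a by lia.
apply: (P3 a b) => //.
have [e|/eqP ne] := eqVneq (z b) b; first by move: k2; rewrite e.
have : b <: z b by apply: le_neq_lt => // /esym.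
by move/P1; lia.
Qed.

End Descend.

Theorem single_atom_good z : involution z -> single_atom z <-> good z.
Proof.
move=> zV; split=> [|zg w w' wz wz'].
  have [m] := ubnP (rank8 z); elim: m z zV => // m IHm z zV lz sz.
  apply: single_good => // i di; apply: IHm.
  - exact: conj_step_involution.
  - have := rank8_conj_step (conj_step_involution i zV) (asc_conj_step_desc di).
    by rewrite conj_stepK //; lia.
  exact: single_atom_conj_step.
have fz := good_few_neg zg.
by apply: (good_unique zV zg); exact: chain_atom_order.
Qed.

Lemma single_atom_involutionsP z :
  z \in single_atom_involutions n <-> involution z /\ good z.
Proof.
rewrite inE; split=> [/andP[zV /eqP/eqP/cards1P[w0 E]]|[zV /(single_atom_good zV) zg]].
  split=> //; apply/single_atom_good => // w w'.
  by move=> /(atomsP _ zV) + /(atomsP _ zV); rewrite E !inE => /eqP-> /eqP->.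
rewrite zV /=; have [w wz] := chain_atom_exists zV.
apply/cards1P; exists w; apply/setP => v; rewrite in_set1.
apply/idP/eqP => [/(atomsP _ zV) vz|->].
  exact: zg.
exact/atomsP.
Qed.

End Single.

(** * Words of involutions *)

(* The letter of i records z(i) = -i (lM), z(i) = i (lF), -i <> z(i) < i (lC,
   i closes a cycle) or i < z(i) (lO, i opens a cycle). *)
Definition letter : finType := option (option bool).
Notation lM := (None : letter).
Notation lF := (Some None : letter).
Notation lC := (Some (Some true) : letter).
Notation lO := (Some (Some false) : letter).

(* Words are read from right to left; s is the part already read, the closers in
   excess in s are the cycles still open, and N is the length of the whole word.
   The bound for lM says that the number of letters still to be read is at least
   the number of open cycles. *)
Definition allowed N (x : letter) (s : seq letter) : bool :=
  match x with
  | None => (lM \notin s) && (count_mem lC s + size s < N + count_mem lO s)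
  | Some None => count_mem lO s == count_mem lC s
  | Some (Some c) => c || (count_mem lO s < count_mem lC s)
  end.

Fixpoint valid N (s : seq letter) : bool :=
  if s is x :: s' then allowed N x s' && valid N s' else true.

Definition height (s : seq letter) : nat := count_mem lC s - count_mem lO s.

Lemma valid_le N s : valid N s -> count_mem lO s <= count_mem lC s.
Proof.
elim: s => //= x s IH /andP[a /IH le]; case: x a => [[[]|]|] //=; lia.
Qed.

Lemma valid_drop N k s : valid N s -> valid N (drop k s).
Proof. by elim: s k => [|x s IH] [|k] //= /andP[_ /IH]. Qed.

Lemma validP N s : reflect
  (forall i, i < size s -> allowed N (nth lM s i) (drop i.+1 s)) (valid N s).
Proof.
elim: s => [|x s IH] /=; first by left.
apply: (iffP andP) => [[a /IH H] [|i]|H]; first by rewrite /= drop0.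
  by rewrite ltnS => /H.
split; first by have := H 0%N isT; rewrite /= drop0.
by apply/IH => i; exact: (H i.+1).
Qed.

(** * Order-reversing self-maps of a finite set of points *)

Section Reversal.
Local Open Scope group_scope.
Variable n : nat.
Implicit Types (A : {set pt n}) (x a b : pt n) (f : pt n -> pt n).

Let ltp : rel (pt n) := fun x a => (pt_int x < pt_int a)%R.

Let ltp_trans : transitive ltp.
Proof. by move=> ? ? ?; rewrite /ltp; lia. Qed.

Definition sorted_pts A : seq (pt n) :=
  sort (fun x a => (pt_int x <= pt_int a)%R) (enum A).

Lemma mem_sorted_pts A x : (x \in sorted_pts A) = (x \in A).
Proof. by rewrite mem_sort mem_enum. Qed.

Lemma sorted_pts_lt A : sorted ltp (sorted_pts A).
Proof.
have : sorted (fun x a => (pt_int x <= pt_int a)%R) (sorted_pts A).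
  by apply: sort_sorted => x a; exact: Order.TotalTheory.le_total.
have : uniq (sorted_pts A) by rewrite sort_uniq enum_uniq.
elim: (sorted_pts A) => //= x s IH /andP[xs us] p.
case: s xs us p IH => //= a s; rewrite inE negb_or => /andP[xa _] us /andP[le p] IH.
rewrite IH // andbT /ltp; move: xa; rewrite eq_pt_int => /eqP; lia.
Qed.

Lemma sorted_pts_uniq A : uniq (sorted_pts A).
Proof. by rewrite sort_uniq enum_uniq. Qed.

Definition reversal A f : Prop := {in A, forall x, f x \in A} /\
  {in A &, forall x a, x <: a -> f a <: f x}.

Lemma reversal_rev A f : reversal A f -> map f (sorted_pts A) = rev (sorted_pts A).
Proof.
move=> [fA fr]; have sr : sorted (fun x a => ltp a x) (rev (sorted_pts A)).
  by rewrite rev_sorted; exact: sorted_pts_lt.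
have finj : {in A &, injective f}.
  move=> x a xA aA e; apply: pt_int_inj.
  case: (Order.TotalTheory.ltgtP (pt_int x) (pt_int a)) => // l.
    by have := fr x a xA aA l; rewrite e; lia.
  by have := fr a x aA xA l; rewrite e; lia.
apply: (irr_sorted_eq (leT := fun x a => ltp a x)) => //.
- by move=> x a b; rewrite /ltp; lia.
- by move=> x; rewrite /ltp; lia.
- have : all [in A] (sorted_pts A) by apply/allP => x; rewrite mem_sorted_pts.
  move=> all_A; exact: (homo_sorted_in (P := [in A]) fr all_A (sorted_pts_lt A)).
have fAE : [set f x | x in A] = A.
  apply/eqP; rewrite eqEcard card_in_imset // leqnn andbT.
  by apply/subsetP => _ /imsetP[x /fA xA ->].
move=> x; rewrite mem_rev mem_sorted_pts; apply/mapP/idP => [[a]|].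
  by rewrite mem_sorted_pts => /fA aA ->.
by rewrite -{1}fAE => /imsetP[a aA ->]; exists a; rewrite ?mem_sorted_pts.
Qed.

Lemma reversal_unique A f g : reversal A f -> reversal A g -> {in A, f =1 g}.
Proof.
move=> /reversal_rev Ef /reversal_rev; rewrite -Ef => /eq_in_map E x xA.
by apply/esym/E; rewrite mem_sorted_pts.
Qed.

Lemma reversal_exists A : exists2 r, reversal A r & {in A, forall x, r (r x) = x}.
Proof.
set s := sorted_pts A; pose m := size s.
pose r x := nth x s (m.-1 - index x s).
have sz x : x \in A -> index x s < m by rewrite -(mem_sorted_pts A) -index_mem.
have rA : {in A, forall x, r x \in A}.
  move=> x /sz xm; rewrite -(mem_sorted_pts A) /r mem_nth // -/m; lia.
have ir x : x \in A -> index (r x) s = (m.-1 - index x s)%N.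
  by move=> /sz xm; rewrite /r index_uniq ?sorted_pts_uniq // -/m; lia.
have nlt := sorted_ltn_nth ltp_trans _ (sorted_pts_lt A).
have nidx x a : x \in A -> nth a s (index x s) = x.
  by move=> xA; rewrite nth_index // mem_sorted_pts.
exists r; first split=> // x a xA aA xa.
  have ix : index x s < index a s.
    rewrite ltnNge leq_eqVlt; apply/negP => /orP[/eqP e|lt].
      by move: xa; rewrite -(nidx x x) // -e nidx //; lia.
    have := nlt x _ _ _ _ lt; rewrite !inE /= -/s !nidx // => /(_ (sz _ aA) (sz _ xA)).
    by rewrite /ltp; lia.
  rewrite /r (set_nth_default x a); last by have := sz _ aA; rewrite -/m; lia.
  by apply: nlt; rewrite ?inE -/s -/m; have := sz _ aA; lia.
move=> x xA; rewrite {1}/r ir // subKn; last by have := sz _ xA; lia.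
rewrite (set_nth_default x) ?nth_index // ?mem_sorted_pts // -/m.
exact: sz.
Qed.

End Reversal.

(** * The word of a good involution is valid and determines it *)

Section Words.
Local Open Scope group_scope.
Variable n : nat.
Implicit Types (z : signed_perm n) (i j : 'I_n) (x a b : pt n) (t : n.-tuple letter).

Lemma count_drop t (p : pred letter) k :
  count p (drop k t) = #|[pred j : 'I_n | (k <= j) && p (tnth t j)]|.
Proof.
rewrite -sum1_card -sum1_count (big_nth lM) size_drop size_tuple.
under eq_bigl => j do rewrite nth_drop addnC.
rewrite -(big_addn 0 n k (fun l : nat => p (nth lM t l)) (fun=> 1%N)) add0n big_geq_mkord.
by apply: eq_bigl => j; rewrite inE andbC (tnth_nth lM).
Qed.

Definition num_from t c k : nat := #|[pred j : 'I_n | (k <= j) && (tnth t j == c)]|.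

Lemma count_mem_drop t c k : count_mem c (drop k t) = num_from t c k.
Proof. by rewrite count_drop. Qed.

Lemma num_fromS t c i : num_from t c i = ((tnth t i == c) + num_from t c i.+1)%N.
Proof.
rewrite -!count_mem_drop (drop_nth lM) ?size_tuple //=.
by rewrite (tnth_nth lM).
Qed.

Definition letter_of z i : letter :=
  if z (pos i) == pos i then lF else if z (pos i) == neg_pt (pos i) then lM
  else Some (Some (pt_int (z (pos i)) < pt_int (pos i))%R).

Definition word_of z : n.-tuple letter := [tuple letter_of z i | i < n].

Lemma tnth_word_of z i : tnth (word_of z) i = letter_of z i.
Proof. by rewrite tnth_map tnth_ord_tuple. Qed.

Lemma letter_F z i : (letter_of z i == lF) = (z (pos i) == pos i).
Proof.
rewrite /letter_of; case: (z (pos i) =P pos i) => // _.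
by case: (z (pos i) =P neg_pt (pos i)).
Qed.

Lemma letter_M z i : (letter_of z i == lM) = (z (pos i) == neg_pt (pos i)).
Proof.
rewrite /letter_of; case: (z (pos i) =P pos i) => [->|_].
  by rewrite [RHS]eq_sym neg_ptN.
by case: (z (pos i) =P neg_pt (pos i)).
Qed.

Lemma letter_C z i : letter_of z i = lC <->
  z (pos i) <: pos i /\ z (pos i) <> neg_pt (pos i).
Proof.
rewrite /letter_of; case: eqP => [->|ne]; first by split=> // -[h _]; exfalso; move: h; lia.
case: eqP => [->|ne']; first by split=> // -[].
by split=> [[->]|[-> _]].
Qed.

Lemma letter_O z i : letter_of z i = lO <-> pos i <: z (pos i).
Proof.
rewrite /letter_of; case: eqP => [->|ne]; first by split=> // h; exfalso; move: h; lia.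
case: eqP => [->|ne']; first
  by split=> // h; exfalso; move: h; rewrite pt_int_neg /pt_int /=; lia.
have : pt_int (z (pos i)) <> pt_int (pos i) by move/pt_int_inj.
by split=> [[]|]; [lia|move=> ?; congr (Some (Some _)); lia].
Qed.

Lemma pos_of x : (0 < pt_int x)%R -> x = pos x.2.
Proof. by case: x => [[] j]. Qed.

Lemma snd_inj_neg x a : x.2 = a.2 -> x = a \/ x = neg_pt a.
Proof. by case: x a => [[] j] [[] k] /= ->; auto. Qed.

Lemma pt_int_pos i : pt_int (pos i) = (i.+1)%:Z%R.
Proof. by []. Qed.

Lemma opener_partner z i : involution z -> letter_of z i = lO ->
  [/\ i < (z (pos i)).2, letter_of z (z (pos i)).2 = lC &
      z (pos i) = pos (z (pos i)).2].
Proof.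
move=> zV /letter_O l; have zp : z (pos i) = pos (z (pos i)).2.
  by apply: pos_of; move: l; rewrite pt_int_pos; lia.
split=> //; first by move: l; rewrite zp !pt_int_pos /=; lia.
apply/letter_C; rewrite -zp invol_inv //; split=> // e.
by move: l; rewrite -[z _]neg_ptK -e pt_int_neg pt_int_pos; lia.
Qed.

Lemma card_le_inj (T T' : finType) (P : pred T) (Q : pred T') (f : T -> T') :
  (forall u, P u -> Q (f u)) -> (forall u v, P u -> P v -> f u = f v -> u = v) ->
  #|P| <= #|Q|.
Proof.
move=> PQ fi; rewrite -(@card_in_image _ _ f P); last by move=> j k; exact: fi.
by apply/subset_leq_card/subsetP => _ /imageP[j /PQ Pj ->].
Qed.

Section GoodWord.
Variable z : signed_perm n.
Hypotheses (zV : involution z) (zg : good z).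

Let t := word_of z.
Let f j := (z (pos j)).2.

Lemma partner_inj j k : f j = f k -> j = k.
Proof.
case/snd_inj_neg; first by move/perm_inj=> [].
by rewrite -sp_neg => /perm_inj.
Qed.

Lemma openers_le k m : (forall j, k <= j -> letter_of z j = lO -> m <= f j) ->
  num_from t lO k <= num_from t lC m.
Proof.
move=> km; apply: (@card_le_inj _ _ _ _ f) => [j|j l _ _]; last exact: partner_inj.
rewrite /= !tnth_word_of => /andP[kj /eqP lj].
by have [? -> _] := opener_partner zV lj; rewrite km ?eqxx.
Qed.

(** A fixed point i would be nested in the non-symmetric cycle of j, and so would {-i, i} if z(j) <
    -i. *)
Lemma crossing_out i j : letter_of z j = lC -> i < j -> z (pos j) <: pos i ->
  z (pos i) <> pos i /\ (z (pos i) = neg_pt (pos i) -> neg_pt (pos i) <: z (pos j)).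
Proof.
move=> /letter_C[l1 l2] ij l3.
have np : neg_pt (z (pos j)) <> pos j by move=> e; apply: l2; rewrite -[LHS]neg_ptK e.
split=> [e|e].
  have g1 : pos i <=: z (pos i) by rewrite e.
  have g2 : z (pos i) <: z (z (pos j)) by rewrite e invol_inv // !pt_int_pos; lia.
  by have [h _] := zg l3 g1 g2; apply: np; rewrite -h invol_inv.
have zj : z (pos j) <> neg_pt (pos i).
  by move/(congr1 z); rewrite invol_inv // sp_neg e neg_ptK => -[ji]; move: ij; rewrite ji ltnn.
apply: le_neq_lt; last exact/not_eq_sym.
case: (Order.TotalTheory.leP (pt_int (neg_pt (pos i))) (pt_int (z (pos j))))
  => // /Order.POrderTheory.ltW l.
have l' : z (pos j) <: neg_pt (pos i) by apply: le_neq_lt.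
have g1 : neg_pt (pos i) <=: z (neg_pt (pos i)).
  by rewrite (negated_neg e) pt_int_neg !pt_int_pos; lia.
have g2 : z (neg_pt (pos i)) <: z (z (pos j)).
  by rewrite (negated_neg e) invol_inv // !pt_int_pos; lia.
by have [_ []] := zg l' g1 g2; rewrite (negated_neg e) neg_ptK.
Qed.

Lemma word_of_valid : valid n t.
Proof.
apply/(validP n t) => k; rewrite size_tuple => kn; pose i := Ordinal kn.
rewrite -(tnth_nth lM t i) tnth_word_of.
have tail_le : num_from t lO k.+1 <= num_from t lC k.+1.
  apply: openers_le => j kj /(opener_partner zV)[]; rewrite /f; lia.
case E: (letter_of z i) => [[[]|]|]; rewrite /allowed ?count_mem_drop //=.
- have : num_from t lO k <= num_from t lC k.+1.
    apply: openers_le => j kj /(opener_partner zV)[]; rewrite /f; lia.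
  by rewrite (num_fromS t lO i) tnth_word_of E eqxx.
- rewrite eqn_leq tail_le /=; move/eqP: E; rewrite letter_F => /eqP zi.
  apply: (@card_le_inj _ _ _ _ f) => [j|j l _ _]; last exact: partner_inj.
  rewrite /= !tnth_word_of => /andP[kj /eqP lj].
  have [l1 l2] := (letter_C z j).1 lj.
  have zj : pos i <: z (pos j).
    have : pt_int (z (pos j)) <> pt_int (pos i).
      move/pt_int_inj/(congr1 z); rewrite invol_inv // zi => -[ji].
      by move: kj; rewrite ji /= ltnn.
    case: (Order.TotalTheory.ltgtP (pt_int (pos i)) (pt_int (z (pos j)))) => [//|l3 _|-> //].
    by have [] := crossing_out lj (kj : i < j) l3.
  have zp : z (pos j) = pos (f j) by apply: pos_of; move: zj; rewrite pt_int_pos; lia.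
  apply/andP; split; first by move: zj; rewrite zp !pt_int_pos /=; lia.
  by apply/eqP/letter_O; rewrite -zp invol_inv.
move/eqP: E; rewrite letter_M => /eqP zi; apply/andP; split.
  change (lM \notin drop k.+1 t); rewrite -has_pred1 has_count -leqNgt leqn0; apply/eqP.
  rewrite count_drop; apply: eq_card0 => j; rewrite !inE /= tnth_word_of letter_M.
  apply/negP => /andP[kj /eqP zj]; have [e|//] := good_few_neg zg zi zj.
  by case: e => e; move: kj; rewrite e /= ltnn.
change (num_from t lC k.+1 + size (drop k.+1 t) < n + num_from t lO k.+1).
rewrite size_drop size_tuple.
(* By [crossing_out], the partner of a closer right of i is an opener right of i, or has absolute
   value below that of i, for which there are [k] places. *)
suff : num_from t lC k.+1 <= num_from t lO k.+1 + k by lia.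
have lt_k : #|[pred j : 'I_n | j < k]| = k.
  by rewrite -sum1_card (big_ord_narrow (ltnW kn)) sum1_card card_ord.
have le : #|[predU [pred j : 'I_n | (k.+1 <= j) && (tnth t j == lO)] &
    [pred j : 'I_n | j < k]]| <= num_from t lO k.+1 + k.
  by rewrite -[X in (_ + X)%N]lt_k -cardUI leq_addr.
apply: leq_trans le.
apply: (@card_le_inj _ _ _ _ f) => [j|j l _ _]; last exact: partner_inj.
rewrite inE /= !tnth_word_of => /andP[kj /eqP lj].
have [l1 l2] := (letter_C z j).1 lj.
case: (Order.TotalTheory.ltgtP (pt_int (pos i)) (pt_int (z (pos j)))) => [l3|l3|e].
- have zp : z (pos j) = pos (f j) by apply: pos_of; move: l3; rewrite pt_int_pos; lia.
  apply/orP; left; rewrite inE tnth_word_of; apply/andP; split.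
    by move: l3; rewrite zp !pt_int_pos /=; lia.
  by apply/eqP/letter_O; rewrite -zp invol_inv.
- have [_ /(_ zi) l4] := crossing_out lj (kj : i < j) l3.
  apply/orP; right; rewrite inE /f; move: l3 l4; rewrite pt_int_neg !pt_int_pos /pt_int /=.
  by case: (z (pos j)) => [[] m] /=; lia.
move/pt_int_inj/(congr1 z): e; rewrite invol_inv // zi => e.
by move/(congr1 (fun x => x.1)): e.
Qed.

(** Closers with a positive partner cancel against the openers. The others satisfy z(j) = -k with k
    <> j, and then k is such a closer as well, so they come in pairs {j, k}. *)
Lemma word_of_even : ~~ odd (height t).
Proof.
have cC c : count_mem c t = num_from t c 0 by rewrite -count_mem_drop drop0.
rewrite /height !cC.
pose X := [pred j : 'I_n | (tnth t j == lC) && (pt_int (z (pos j)) < 0)%R].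
pose Y := [pred j : 'I_n | (tnth t j == lC) && (0 < pt_int (z (pos j)))%R].
have eC : num_from t lC 0 = (#|X| + #|Y|)%N.
  rewrite -cardUI [X in _ = (_ + X)%N](eq_card0 _) ?addn0 => [|j]; last first.
    by rewrite !inE; case: eqP => //= _; lia.
  apply: eq_card => j; rewrite !inE -andb_orr; case: eqP => //= _.
  by have := @pt_int_neq0 n (z (pos j)); lia.
have eO : #|Y| = num_from t lO 0.
  apply/eqP; rewrite eqn_leq; apply/andP; split.
    apply: (@card_le_inj _ _ _ _ f) => [j|j l _ _]; last exact: partner_inj.
    rewrite /= !tnth_word_of => /andP[/eqP/letter_C[l1 l2] /pos_of zp].
    by apply/eqP/letter_O; rewrite -zp invol_inv.
  apply: (@card_le_inj _ _ _ _ f) => [j|j l _ _]; last exact: partner_inj.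
  rewrite /= !tnth_word_of => /eqP lj; have [_ -> zp] := opener_partner zV lj.
  by rewrite eqxx -zp invol_inv.
rewrite eC eO addnK.
have fX j : X j -> [/\ X (f j), f (f j) = j & f j != j].
  rewrite /= !tnth_word_of => /andP[/eqP/letter_C[l1 l2] zn].
  have zj : z (pos j) = neg_pt (pos (f j)).
    by move: zn; rewrite /f /pt_int; case: (z (pos j)) => [[] m] //=; lia.
  have zf : z (pos (f j)) = neg_pt (pos j).
    by apply: (can_inj (@neg_ptK n)); rewrite -sp_neg -zj invol_inv // neg_ptK.
  have fj : f j != j by apply/eqP => e; apply: l2; rewrite zj e.
  split=> //; last by rewrite {1}/f zf.
  rewrite zf; apply/andP; split; last by rewrite pt_int_neg pt_int_pos; lia.
  apply/eqP/letter_C; rewrite zf pt_int_neg !pt_int_pos; split; first by lia.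
  by move/(can_inj (@neg_ptK n)) => -[e]; rewrite -e eqxx in fj.
pose X1 := [pred j | X j && (j < f j)]; pose X2 := [pred j | X j && (f j < j)].
have -> : #|X| = (#|X1| + #|X2|)%N.
  rewrite -cardUI [X in _ = (_ + X)%N](eq_card0 _) ?addn0 => [|j]; last first.
    by rewrite !inE; case: (X j) => //=; lia.
  apply: eq_card => j; rewrite !inE -andb_orr.
  rewrite -![(tnth t j == lC) && _]/(X j); have := fX j.
  by case: (X j) => // /(_ isT)[_ _]; rewrite -val_eqE /=; lia.
have -> : #|X1| = #|X2|.
  apply/eqP; rewrite eqn_leq; apply/andP.
  by split; apply: (@card_le_inj _ _ _ _ f) => [j|j l _ _]; try exact: partner_inj;
    by move=> /andP[/fX[Xf ff _] lt]; apply/andP; split; [exact: Xf|rewrite ff].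
by rewrite addnn odd_double.
Qed.

End GoodWord.

(** The letter of |x| decides in both cases, since -i opens a cycle exactly if i closes one. *)
Definition opener t x : bool := tnth t x.2 == (if x.1 then lC else lO).
Definition openers t : {set pt n} := [set x | opener t x].

Lemma openers_word z : involution z ->
  forall x, (x \in openers (word_of z)) = (pt_int x < pt_int (z x))%R && (z x != neg_pt x).
Proof.
move=> zV [[] j]; rewrite inE /opener tnth_word_of /=.
  rewrite -[(true, j)]/(neg_pt (pos j)) sp_neg (inj_eq (can_inj (@neg_ptK n))) !pt_int_neg.
  apply/eqP/andP => [/letter_C[l /eqP ne]|[l /eqP ne]]; first by split=> //; lia.
  by apply/letter_C; split=> //; lia.
rewrite -[(false, j)]/(pos j).
apply/eqP/andP => [/letter_O l|[l _]]; last by apply/letter_O.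
by split=> //; apply/eqP => e; move: l; rewrite e pt_int_neg pt_int_pos; lia.
Qed.

(** Cycles that are not symmetric are not nested in one another, so z is increasing on the openers;
    and -z(x) opens the mirror image of the cycle of x. Thus z is determined on the openers by their
    set alone. *)
Lemma good_reversal z : involution z -> good z ->
  reversal (openers (word_of z)) (fun x => neg_pt (z x)).
Proof.
move=> zV zg; split=> [x|x a].
  rewrite !openers_word // => /andP[l /eqP ne]; rewrite sp_neg invol_inv // !pt_int_neg.
  rewrite (inj_eq (can_inj (@neg_ptK n))); apply/andP; split; first by lia.
  by apply/eqP => e; apply: ne; rewrite {2}e neg_ptK.
rewrite !openers_word // => /andP[lx /eqP nx] /andP[la /eqP na] xa; rewrite !pt_int_neg.
suff : z x <: z a by lia.
case: (Order.TotalTheory.ltgtP (pt_int (z x)) (pt_int (z a))) => // [l|/pt_int_inj/perm_inj e].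
  by case: (zg _ _ xa _ l) => //; lia.
by move: xa; rewrite e; lia.
Qed.

Lemma word_of_inj z z' : involution z -> good z -> involution z' -> good z' ->
  word_of z = word_of z' -> z = z'.
Proof.
move=> zV zg zV' zg' E.
have R := good_reversal zV zg; have R' := good_reversal zV' zg'.
rewrite -E in R'.
have zA x : x \in openers (word_of z) -> z x = z' x.
  by move/(reversal_unique R R')/(can_inj (@neg_ptK n)).
have zP j : z (pos j) = z' (pos j).
  have := congr1 (fun t => tnth t j) E; rewrite !tnth_word_of.
  case El: (letter_of z j) => [[[]|]|] /esym El'.
  - apply: (can_inj (@neg_ptK n)); rewrite -!sp_neg; apply: zA.
    by rewrite inE /opener /= tnth_word_of El.
  - by apply: zA; rewrite inE /opener /= tnth_word_of El.
  - by move/eqP: El; move/eqP: El'; rewrite !letter_F => /eqP-> /eqP->.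
  by move/eqP: El; move/eqP: El'; rewrite !letter_M => /eqP-> /eqP->.
apply: spP => -[[] j]; last exact: zP.
by rewrite -[(true, j)]/(neg_pt (pos j)) !sp_neg zP.
Qed.
End Words.

(** * Reconstruction of a good involution from a valid word of even height *)

Section Build.
Local Open Scope group_scope.
Variables (n : nat) (t : n.-tuple letter).
Hypotheses (tv : valid n t) (te : ~~ odd (height t)).
Implicit Types (i j : 'I_n) (x a b : pt n).

Local Notation A := (openers t).

Lemma openers_neg x : x \in A -> neg_pt x \notin A.
Proof. by case: x => [[] j]; rewrite !inE /opener /= => /eqP->. Qed.

Lemma allowed_at i : allowed n (tnth t i) (drop i.+1 t).
Proof. by rewrite (tnth_nth lM); apply: (validP n t tv); rewrite size_tuple. Qed.

Lemma num_from_le k : num_from t lO k <= num_from t lC k.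
Proof. by rewrite -!count_mem_drop; apply: (@valid_le n); exact: valid_drop. Qed.

Lemma card_pt (P : pred (pt n)) :
  #|P| = (#|[pred j | P (neg_pt (pos j))]| + #|[pred j | P (pos j)]|)%N.
Proof.
rewrite -(cardID [pred x : pt n | x.1] P); congr (_ + _)%N.
  rewrite -(@card_image _ _ (fun j => neg_pt (pos j))); last by move=> j k [].
  apply: eq_card => x; rewrite !inE; apply/andP/imageP => [[xP]|[j jP ->]]; last by [].
  by case: x xP => [[] j] // jP _; exists j.
rewrite -(@card_image _ _ (@pos n)); last by move=> j k [].
apply: eq_card => x; rewrite !inE; apply/andP/imageP => [[]|[j jP ->]]; last by [].
by case: x => [[] j] // _ jP; exists j.
Qed.

Lemma openers_pos j : (pos j \in A) = (tnth t j == lO).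
Proof. by rewrite inE. Qed.

Lemma openers_negpos j : (neg_pt (pos j) \in A) = (tnth t j == lC).
Proof. by rewrite inE. Qed.

Lemma num_from_split c k :
  num_from t c 0 = (#|[pred j : 'I_n | (j < k) && (tnth t j == c)]| + num_from t c k)%N.
Proof.
rewrite -cardUI [X in _ = (_ + X)%N](eq_card0 _) ?addn0 => [|j]; last first.
  by rewrite !inE; case: (tnth t j == c); rewrite ?andbF ?andbT //; lia.
apply: eq_card => j; rewrite !inE; case: (tnth t j == c); rewrite ?andbF ?andbT //; lia.
Qed.

(** Closing points are the negatives of openers, so [below] and [below_neg] count the cycles opened
    and closed up to [b]. *)
Definition below b := #|[pred x in A | pt_int x <= pt_int b]%R|.
Definition below_neg b := #|[pred x in A | - pt_int x <= pt_int b]%R|.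

Lemma below_negpos i : below (neg_pt (pos i)) = num_from t lC i.
Proof.
rewrite /below card_pt [X in (_ + X)%N](eq_card0 _) ?addn0 => [|j]; last first.
  by rewrite !inE /= pt_int_neg !pt_int_pos; apply/andP => -[_]; lia.
apply: eq_card => j; rewrite 2!unfold_in /= openers_negpos !pt_int_neg !pt_int_pos.
by rewrite andbC; congr (_ && _); lia.
Qed.

Lemma below_neg_negpos i : below_neg (neg_pt (pos i)) = num_from t lO i.
Proof.
rewrite /below_neg card_pt [X in (X + _)%N](eq_card0 _) ?add0n => [|j]; last first.
  by rewrite !inE /= !pt_int_neg !pt_int_pos; apply/andP => -[_]; lia.
apply: eq_card => j; rewrite 2!unfold_in /= openers_pos !pt_int_neg !pt_int_pos.
by rewrite andbC; congr (_ && _); lia.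
Qed.

Lemma below_pos i :
  (below (pos i) + num_from t lO i.+1 = num_from t lC 0 + num_from t lO 0)%N.
Proof.
rewrite /below card_pt (num_from_split lO i.+1) addnA; congr (_ + _ + _)%nat.
  apply: eq_card => j; rewrite 2!unfold_in /= openers_negpos !pt_int_neg !pt_int_pos.
  by rewrite andbC; congr (_ && _); lia.
apply: eq_card => j; rewrite 2!unfold_in /= openers_pos !pt_int_pos.
by rewrite andbC; congr (_ && _); lia.
Qed.

Lemma below_neg_pos i :
  (below_neg (pos i) + num_from t lC i.+1 = num_from t lC 0 + num_from t lO 0)%N.
Proof.
rewrite /below_neg card_pt (num_from_split lC i.+1) [RHS]addnAC; congr (_ + _ + _)%N.
  apply: eq_card => j; rewrite 2!unfold_in /= openers_negpos !pt_int_neg !pt_int_pos.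
  by rewrite andbC; congr (_ && _); lia.
apply: eq_card => j; rewrite 2!unfold_in /= openers_pos !pt_int_pos.
by rewrite andbC; congr (_ && _); lia.
Qed.

Lemma card_openers : #|A| = (num_from t lC 0 + num_from t lO 0)%N.
Proof.
have -> : #|A| = #|[pred x | x \in A]| by apply: eq_card.
rewrite card_pt; congr (_ + _)%N; apply: eq_card => j.
  by rewrite 2!unfold_in /= openers_negpos.
by rewrite 2!unfold_in /= openers_pos.
Qed.

Lemma pt_cases x : exists i, x = pos i \/ x = neg_pt (pos i).
Proof. by case: x => [[] i]; exists i; [right|left]. Qed.

(** At a negative point the difference is the surplus of [lC] in a suffix of the word; at a positive
    point, complementing the counts gives such a surplus again. *)
Lemma ballot b : below_neg b <= below b.
Proof.
have [i [->|->]] := pt_cases b; last by rewrite below_negpos below_neg_negpos num_from_le.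
by have := below_pos i; have := below_neg_pos i; have := num_from_le i.+1; lia.
Qed.

Lemma ballot_fixed b : tnth t b.2 = lF -> below_neg b = below b.
Proof.
move=> bF; have := allowed_at b.2; rewrite bF /= => /eqP.
rewrite !count_mem_drop => e; move: bF.
have [i [be|be]] := pt_cases b; rewrite be /= in e * => bF.
  by have := below_pos i; have := below_neg_pos i; lia.
by rewrite below_negpos below_neg_negpos !num_fromS bF e.
Qed.

Section Matching.
Variable r : pt n -> pt n.
Hypotheses (rA : {in A, forall x, r x \in A})
  (mate_anti : {in A &, forall x a, x <: a -> r a <: r x})
  (rK : {in A, forall x, r (r x) = x}).

Lemma mate_inj x a : x \in A -> a \in A -> r x = r a -> x = a.
Proof. by move=> xA aA e; rewrite -(rK xA) e rK. Qed.

(** A fixed point of [r] would be the middle of [A], but the size of [A] has the parity of the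
    height. *)
Lemma mate_neq a : a \in A -> r a <> a.
Proof.
move=> aA ra; pose X := [pred x in A | pt_int x < pt_int a]%R.
pose Y := [pred x in A | pt_int a < pt_int x]%R.
have XY : #|X| = #|Y|.
  apply/eqP; rewrite eqn_leq; apply/andP.
  split; apply: (@card_le_inj _ _ _ _ r) => [x|x x' /andP[xA _] /andP[xA' _]];
    try exact: mate_inj; move=> /andP[xA xa]; apply/andP; rewrite rA // -ra; split=> //;
    by apply: mate_anti.
have : #|A| = (#|X| + #|Y|).+1.
  rewrite -cardUI [X in _ = (_ + X).+1%N](eq_card0 _) ?addn0 => [|x]; last first.
    by rewrite !inE; case: (opener t x) => //=; lia.
  rewrite (cardsD1 a) aA add1n; congr _.+1; apply: eq_card => x; rewrite !inE.
  rewrite eq_pt_int; case: (opener t x); rewrite ?andbF ?andbT //=; lia.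
rewrite card_openers XY addnn => e; move: te; rewrite /height.
have -> : count_mem lC t = num_from t lC 0 by rewrite -count_mem_drop drop0.
have -> : count_mem lO t = num_from t lO 0 by rewrite -count_mem_drop drop0.
by have := num_from_le 0; lia.
Qed.

(** If b = -r(a) preceded a, [r] would map the openers up to a to openers whose cycles are closed by
    b, so more cycles would be closed than opened at b. *)
Lemma mate_opens a : a \in A -> a <: neg_pt (r a).
Proof.
move=> aA; have na : neg_pt (r a) <> a.
  by move=> e; have := openers_neg (rA aA); rewrite e aA.
case: (Order.TotalTheory.ltgtP (pt_int a) (pt_int (neg_pt (r a)))) => // [l|]; last first.
  by move/pt_int_inj/esym.
set b := neg_pt (r a) in l na; have bb := ballot b.
have : below a <= below_neg b.
  apply: (@card_le_inj _ _ _ _ r) => [x /andP[xA xa]|x x' /andP[xA _] /andP[xA' _]].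
    apply/andP; rewrite rA //; split=> //; rewrite /b pt_int_neg.
    have [->|/eqP ne] := eqVneq x a; first by lia.
    by have := mate_anti xA aA (le_neq_lt xa ne); lia.
  exact: mate_inj.
have : below b < below a.
  apply: proper_card; apply/properP; split.
    by apply/subsetP => x; rewrite !inE => /andP[-> ?]; lia.
  by exists a; rewrite inE; move: aA => ->; rewrite /=; lia.
lia.
Qed.

(** At a letter [lF] all cycles opened are closed, whereas the cycle from a to -r(a) would still be
    open at b. *)
Lemma no_fixed_inside a b : a \in A -> tnth t b.2 = lF -> a <: b ->
  b <: neg_pt (r a) -> False.
Proof.
move=> aA /ballot_fixed e ab bra.
suff : below_neg b < below b by rewrite e ltnn.
pose P := [pred x in A | (pt_int x <= pt_int b)%R && (x != a)].
have : below_neg b <= #|P|.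
  apply: (@card_le_inj _ _ _ _ r) => [x /andP[xA xb]|x x' /andP[xA _] /andP[xA' _]];
    last exact: mate_inj.
  have := mate_opens (rA xA); rewrite rK // pt_int_neg => l.
  apply/and3P; split; [exact: rA|lia|].
  by apply/eqP => e'; move: bra; rewrite -e' rK // pt_int_neg; lia.
have : #|P| < below b.
  apply: proper_card; apply/properP; split.
    by apply/subsetP => x; rewrite !inE => /and3P[-> -> _].
  by exists a; rewrite !inE /= ?eqxx ?andbF //; move: aA; rewrite inE => ->; rewrite /=; lia.
lia.
Qed.

Lemma letter_M_unique i j : tnth t i = lM -> tnth t j = lM -> i = j.
Proof.
have H k l : tnth t k = lM -> tnth t l = lM -> k < l -> False.
  move=> tk tl kl; have := allowed_at k; rewrite tk /= => /andP[+ _].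
  case/negP; rewrite -tl (tnth_nth lM); apply/(nthP lM); exists (l - k.+1)%N.
    by rewrite size_drop size_tuple; have := ltn_ord l; lia.
  by rewrite nth_drop subnKC.
by move=> ti tj; case: (ltngtP i j) => [/H|/H|/val_inj] // [].
Qed.

(** All letters before i would be [lC] or [lO]. [r] would map the openers above -i to those up to
    -i, missing r(a), so more than half of the openers would lie up to -i; the bound in [allowed]
    for [lM] says that at most half of them do. *)
Lemma no_negated_inside_word a i : a \in A -> tnth t i = lM -> a <: neg_pt (pos i) ->
  pos i <: neg_pt (r a) -> False.
Proof.
move=> aA iM ai ira; set b := neg_pt (pos i) in ai *.
have := allowed_at i; rewrite iM /= => /andP[_].
rewrite !count_mem_drop size_drop size_tuple => H.
have noFM j : j < i -> tnth t j = lC \/ tnth t j = lO.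
  move=> ji; case E: (tnth t j) => [[[]|]|]; [by left|by right| |].
    case: (@no_fixed_inside a (pos j)) => //.
      by move: ai; rewrite /b pt_int_neg !pt_int_pos; lia.
    by move: ira; rewrite !pt_int_pos; lia.
  by move: ji; rewrite (letter_M_unique E iM) ltnn.
have lt_i : #|[pred j : 'I_n | j < i]| = i.
  by rewrite -sum1_card (big_ord_narrow (ltnW (ltn_ord i))) sum1_card card_ord.
have iE : (i = #|[pred j : 'I_n | (j < i) && (tnth t j == lC)]| +
    #|[pred j : 'I_n | (j < i) && (tnth t j == lO)]| :> nat)%N.
  rewrite -[LHS]lt_i -cardUI [X in _ = (_ + X)%N](eq_card0 _) ?addn0 => [|j]; last first.
    by rewrite !inE; case: eqP => [->|]; rewrite ?andbF.
  apply: eq_card => j; rewrite !inE; case: (boolP (j < i)) => //= /noFM[] ->;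
  by rewrite eqxx ?orbT.
have bC : below b = num_from t lC i.+1 by rewrite below_negpos num_fromS iM.
have lO_i : num_from t lO i = num_from t lO i.+1 by rewrite num_fromS iM.
have lC_i : num_from t lC i = num_from t lC i.+1 by rewrite num_fromS iM.
have sC := num_from_split lC i; have sO := num_from_split lO i.
pose Q := [pred x in A | ~~ (pt_int x <= pt_int b)%R].
have cQ : (below b + #|Q| = #|A|)%N.
  rewrite /below -(cardID [pred x | pt_int x <= pt_int b]%R A); congr (_ + _)%N.
  by apply: eq_card => x; rewrite !inE andbC.
pose P := [pred x in A | (pt_int x <= pt_int b)%R && (x != r a)].
have PQ : #|Q| <= #|P|.
  apply: (@card_le_inj _ _ _ _ r) => [x /andP[xA xb]|x x' /andP[xA _] /andP[xA' _]];
    last exact: mate_inj.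
  have ax : a <: x by lia.
  have := mate_anti aA xA ax => l.
  apply/and3P; split; [exact: rA| |].
    by move: ira l; rewrite /b !pt_int_neg; lia.
  by apply/eqP => /(mate_inj xA aA) e; move: ax; rewrite e; lia.
have : #|P| < below b.
  apply: proper_card; apply/properP; split.
    by apply/subsetP => x; rewrite !inE => /and3P[-> -> _].
  exists (r a); rewrite !inE /= ?eqxx ?andbF //; move: (rA aA); rewrite inE => ->.
  by rewrite /b; move: ira; rewrite /= !pt_int_neg; lia.
by move: cQ; rewrite card_openers; lia.
Qed.

Definition match_pt x : pt n :=
  if x \in A then neg_pt (r x) else if neg_pt x \in A then r (neg_pt x)
  else if tnth t x.2 == lM then neg_pt x else x.

Lemma openers_negN x : neg_pt x \in A -> x \notin A.
Proof. by move/openers_neg; rewrite neg_ptK. Qed.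

Lemma match_neg x : match_pt (neg_pt x) = neg_pt (match_pt x).
Proof.
rewrite /match_pt neg_ptK; case: ifP => [xn|xn].
  by rewrite (negPf (openers_negN xn)).
by case: ifP => _; rewrite ?neg_ptK //=; case: ifP => _; rewrite ?neg_ptK.
Qed.

Lemma matchK : involutive match_pt.
Proof.
move=> x; rewrite {2}/match_pt; case: ifP => [xA|xA].
  by rewrite match_neg /match_pt rA // rK // neg_ptK.
case: ifP => [nA|nA]; first by rewrite /match_pt rA // rK // neg_ptK.
case: ifP => M; last by rewrite /match_pt xA nA M.
by rewrite match_neg /match_pt xA nA M neg_ptK.
Qed.

Definition match_perm : {perm pt n} := perm (can_inj matchK).

Lemma match_signed : is_signed match_perm.
Proof. by apply/forallP => x; rewrite !permE match_neg. Qed.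

Definition match_sp : signed_perm n := SignedPerm match_signed.

Lemma match_spE x : match_sp x = match_pt x.
Proof. by rewrite permE. Qed.

Lemma match_involution : involution match_sp.
Proof.
apply/eqP/(mulgI match_sp); rewrite mulgV; apply: spP => x.
by rewrite spM !match_spE matchK sp1.
Qed.

Lemma match_word : word_of match_sp = t.
Proof.
apply: eq_from_tnth => i; rewrite tnth_word_of.
case E: (tnth t i) => [[[]|]|].
- have iA : neg_pt (pos i) \in A by rewrite openers_negpos E.
  apply/letter_C; rewrite match_spE /match_pt (negPf (openers_negN iA)) iA.
  have := mate_opens iA; rewrite !pt_int_neg => l; split; first by lia.
  exact: mate_neq iA.
- have iA : pos i \in A by rewrite openers_pos E.
  apply/letter_O; rewrite match_spE /match_pt iA; exact: mate_opens.
- by apply/eqP; rewrite letter_F match_spE /match_pt openers_pos openers_negpos E.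
by apply/eqP; rewrite letter_M match_spE /match_pt openers_pos openers_negpos E.
Qed.

Lemma match_closes x : neg_pt x \in A -> match_sp x <: x.
Proof.
move=> xA; rewrite match_spE /match_pt (negPf (openers_negN xA)) xA.
by have := mate_opens xA; rewrite !pt_int_neg; lia.
Qed.

Lemma not_openers_letter x : x \notin A -> neg_pt x \notin A ->
  tnth t x.2 = lM \/ tnth t x.2 = lF.
Proof.
have [i [->|->]] := pt_cases x; rewrite ?neg_ptK openers_pos openers_negpos /=;
by case: (tnth t i) => [[[]|]|] //; auto.
Qed.

Lemma match_good : good match_sp.
Proof.
move=> a b ab bz zba.
have nbA : neg_pt b \notin A by apply/negP => /match_closes; lia.
have naA : neg_pt a \notin A by apply/negP => /match_closes; lia.
have fixed x : x \notin A -> neg_pt x \notin A -> tnth t x.2 = lF -> match_sp x = x.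
  by move=> xA nA xF; rewrite match_spE /match_pt (negPf xA) (negPf nA) xF.
have negd x : x \notin A -> neg_pt x \notin A -> tnth t x.2 = lM ->
    match_sp x = neg_pt x.
  by move=> xA nA xM; rewrite match_spE /match_pt (negPf xA) (negPf nA) xM.
have neg_b : tnth t b.2 = lM -> b \notin A -> b = neg_pt (pos b.2).
  move=> bM bA; move: bz; rewrite negd //.
  by case: b {ab zba nbA bM bA} => [[] j] //; rewrite /pt_int /=; lia.
have op x : x \in A -> match_sp x = neg_pt (r x).
  by move=> xA; rewrite match_spE /match_pt xA.
case: (boolP (a \in A)) => aA; last first.
  have [aM|aF] := not_openers_letter aA naA; last first.
    by move: zba bz; rewrite (fixed a) //; lia.
  split; first exact: negd.
  case: (boolP (b \in A)) => bA.
    by rewrite op // => /(can_inj (@neg_ptK n)); exact: mate_neq.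
  have [bM|bF] := not_openers_letter bA nbA; last first.
    by rewrite fixed // => /esym /neg_pt_neq.
  move=> _; have e := letter_M_unique aM bM.
  have bE := neg_b bM bA.
  case: (snd_inj_neg e) => ae; move: ab; rewrite ae; first by lia.
  by rewrite bE !pt_int_neg !pt_int_pos; lia.
exfalso; case: (boolP (b \in A)) => bA.
  by have := mate_anti aA bA ab; move: zba; rewrite !op // !pt_int_neg; lia.
rewrite (op a) // in zba.
have [bM|bF] := not_openers_letter bA nbA.
  have bE := neg_b bM bA.
  apply: (no_negated_inside_word aA bM); first by rewrite -bE.
  by move: zba; rewrite (negd b) // {1}bE neg_ptK.
by apply: (no_fixed_inside aA bF ab); rewrite -[b](fixed b).
Qed.

End Matching.

Lemma word_of_surj : exists z, [/\ involution z, good z & word_of z = t].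
Proof.
have [r [rA ra] rK] := reversal_exists A.
exists (match_sp rA rK); split; first exact: match_involution.
  exact: match_good.
exact: match_word.
Qed.

End Build.

Theorem num_single_words n :
  num_single n = #|[set t : n.-tuple letter | valid n t && ~~ odd (height t)]|.
Proof.
rewrite /num_single -(@card_in_imset _ _ (@word_of n)); last first.
  move=> z z' /single_atom_involutionsP[zV zg] /single_atom_involutionsP[zV' zg'].
  exact: word_of_inj.
apply: eq_card => t; rewrite [RHS]inE; apply/imsetP/andP => [[z]|[tv te]].
  move=> /single_atom_involutionsP[zV zg] ->; split; first exact: word_of_valid.
  exact: word_of_even.
have [z [zV zg <-]] := word_of_surj tv te.
by exists z => //; apply/single_atom_involutionsP.
Qed.

Lemma num_single_split n :
  num_single n = (num_single_neg n 0 + num_single_neg n 1)%N.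
Proof.
rewrite /num_single /num_single_neg.
set S0 := [set z in _ | _ == 0%N]; set S1 := [set z in _ | _ == 1%N].
have d : S0 :&: S1 = set0.
  apply/setP => z; rewrite !in_set; case: (#|negated_points z| =P 0%N) => [->|_].
    by rewrite !andbF.
  by rewrite andbF.
have := cardsUI S0 S1; rewrite d cards0 addn0 => <-.
apply: eq_card => z; rewrite [RHS]in_setU [z \in S0]in_set [z \in S1]in_set -andb_orr.
case: (boolP (z \in _)) => //= /single_atom_involutionsP[zV zg].
suff : #|negated_points z| <= 1 by case: (#|_|) => [|[]].
apply/card_le1_eqP => i j; rewrite !inE => /eqP zi /eqP zj.
by case: (good_few_neg zg zj zi) => -[].
Qed.

(** * Counting the words *)

(* tail m r is the sum of the 'C(m, i) for i >= r *)
Fixpoint tail m r : nat := if m is m'.+1 then tail m' r + tail m' r.-1 else r == 0.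

Lemma tail_bin m r : tail m r = tail m r.+1 + 'C(m, r).
Proof.
elim: m r => [|m IH] [|r] //=; first by rewrite (IH 0) !bin0; lia.
by have := IH r.+1; have := IH r; rewrite binS; lia.
Qed.

Lemma tail0 m : tail m 0 = 2 ^ m.
Proof. by elim: m => //= m ->; rewrite expnS; lia. Qed.

Lemma tail_big m r : m < r -> tail m r = 0.
Proof. by elim: m r => [|m IH] [|r] //= lt; rewrite !IH //; lia. Qed.

Lemma tail_sym m r : r <= m.+1 -> tail m r + tail m (m.+1 - r) = 2 ^ m.
Proof.
elim: m r => [|m IH] r le; first by case: r le => [|[|]].
rewrite expnS /=; case: r le => [|r] le.
  by rewrite subn0 /= (@tail_big m m.+2) // (@tail_big m m.+1) // !tail0; lia.
have [->|lt] := eqVneq r m.+1.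
  by rewrite subnn /= (@tail_big m m.+2) // (@tail_big m m.+1) // !tail0; lia.
have := IH r.+1; have := IH r; rewrite (_ : m.+2 - r.+1 = (m - r).+1) /=; last by lia.
by rewrite subSS (subSn (_ : r <= m)); lia.
Qed.

(** The sum of 2^(m - 1 - k) [tail k r] over k < m; k is the number of letters read before [lM]. *)
Fixpoint tail_sum m r : nat := if m is m'.+1 then 2 * tail_sum m' r + tail m' r else 0.

Lemma tail_sumE m r : tail_sum m r.+1 + r.+1 * tail m r.+1 = m * tail m.-1 r.
Proof.
elim: m => [|m IH] /=; first by rewrite muln0.
case: m IH => [|m] IH; first by case: r {IH} => [|r] /=; lia.
have e1 := tail_bin m.+1 r.
case: r IH e1 => [|r] IH e1.
  by rewrite bin0 in e1; move: IH e1; rewrite /=; nia.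
have e2 : r.+1 * 'C(m.+1, r.+1) = m.+1 * 'C(m, r) by rewrite mul_bin_diag.
have e3 := tail_bin m r.
have e4 : tail m.+1 r.+1 = tail m r.+1 + tail m r by [].
by move: IH; rewrite [m.+1.-1]/=; nia.
Qed.

(* Reading one more letter C, or O or F, moves the height from h to h.+1, or to
   h.-1 = max(h - 1, 0); dual g q is the q-fold transpose of this step applied to g. *)
Fixpoint dual (g : nat -> nat) q h : nat :=
  if q is q'.+1 then dual g q' h.+1 + dual g q' h.-1 else g h.

Definition from_par c h : nat := (c <= h) && (odd h == odd c).

(** From height at least [q], the boundary rule does not act within [q] steps, so all 2^q walks
    count, with a prescribed parity at the end. *)
Lemma dual_large q h : q <= h -> dual (from_par 0) q h = 2 ^ q * (odd h == odd q).
Proof.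
elim: q h => [|q IH] [|h] //= le; first by rewrite /from_par mul1n.
rewrite !IH /=; try lia.
by rewrite expnS negbK; case: (odd h); case: (odd q) => /=; lia.
Qed.

(* the number of walks of length m with steps +1, -1 ending in {d, d + 2, ...} *)
Fixpoint free m (d : int) : nat :=
  if m is m'.+1 then free m' (d - 1)%R + free m' (d + 1)%R
  else (d <= 0)%R && ~~ odd `|d|.

(* Reflection principle: the boundary rule h.-1 = h for h = 0 is that of the
   extension to negative heights by h <-> - 1 - h. *)
Lemma dual_free c m h :
  dual (from_par c) m h = free m (c%:Z - h%:Z)%R + free m (c%:Z + 1 + h%:Z)%R.
Proof.
elim: m h => [|m IH] h /=.
  rewrite /from_par; have -> : (c%:Z + 1 + h%:Z <= 0)%R = false by lia.
  rewrite addn0; congr nat_of_bool.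
  case: (leqP c h) => [le|lt]; last by rewrite (_ : (_ <= 0)%R = false) //; lia.
  rewrite (_ : (_ <= 0)%R = true) /=; last by lia.
  rewrite (_ : `|(c%:Z - h%:Z)%R|%N = h - c); last by lia.
  by rewrite oddB // -negb_eqb negbK eq_sym.
rewrite !IH; case: h => [|h] /=.
  rewrite (_ : (c%:Z - 1%:Z)%R = (c%:Z - 0%:Z - 1)%R); last by lia.
  rewrite (_ : (c%:Z + 1 + 1%:Z)%R = (c%:Z + 1 + 0%:Z + 1)%R); last by lia.
  rewrite (_ : (c%:Z - 0%:Z + 1)%R = (c%:Z + 1 + 0%:Z)%R); last by lia.
  rewrite (_ : (c%:Z + 1 + 0%:Z - 1)%R = (c%:Z - 0%:Z)%R); last by lia.
  by lia.
rewrite (_ : (c%:Z - h.+2%:Z)%R = (c%:Z - h.+1%:Z - 1)%R); last by lia.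
rewrite (_ : (c%:Z - h%:Z)%R = (c%:Z - h.+1%:Z + 1)%R); last by lia.
rewrite (_ : (c%:Z + 1 + h.+2%:Z)%R = (c%:Z + 1 + h.+1%:Z + 1)%R); last by lia.
rewrite (_ : (c%:Z + 1 + h%:Z)%R = (c%:Z + 1 + h.+1%:Z - 1)%R); last by lia.
by lia.
Qed.

(** The two terms together count the walks ending at d or above, and a walk with i upward steps ends
    at 2i - m. The second alternative covers r = 0, where [r.-1] no longer decreases. *)
Lemma free_tail m (d : int) r :
  (m%:Z + d <= r%:Z *+ 2 <= m%:Z + d + 1)%R \/ (m%:Z + d <= 0)%R /\ r = 0 ->
  free m d + free m (d + 1)%R = tail m r.
Proof.
elim: m d r => [|m IH] d r H /=; first by lia.
rewrite -(IH (d + 1)%R r); last by lia.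
rewrite -(IH (d - 1)%R r.-1); last by lia.
by rewrite GRing.subrK GRing.addrK; lia.
Qed.

Lemma dual_tail c m r : m + c <= r.*2 <= (m + c).+1 ->
  dual (from_par c) m 0 = tail m r.
Proof.
by move=> H; rewrite dual_free -(@free_tail m c r); [congr (_ + _); congr free|]; lia.
Qed.

(** * Counting valid words by walks of the height *)

Section CountWords.
Variable n : nat.

Lemma sum_letter (G : letter -> nat) :
  \sum_(x : letter) G x = G lM + G lF + G lC + G lO.
Proof.
rewrite (bigD1 lM) //= (bigD1 lF) //= (bigD1 lC) //= (bigD1 lO) //= big1; first by lia.
by case=> [[[]|]|].
Qed.

Lemma sum_tuple_cons (T : finType) m (P : pred (seq T)) (F : seq T -> nat) :
  \sum_(s : m.+1.-tuple T | P s) F s =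
  \sum_(x : T) \sum_(s : m.-tuple T | P (x :: s)) F (x :: s).
Proof.
have bij : bijective (fun p : T * m.-tuple T => [tuple of p.1 :: p.2]).
  exists (fun s : m.+1.-tuple T => (thead s, [tuple of behead s])) => [[x s]|s] /=.
    by congr (_, _); apply: val_inj.
  by rewrite -tuple_eta.
by rewrite pair_big_dep (reindex _ (onW_bij _ bij)).
Qed.

Definition heights m (P : pred (seq letter)) (g : nat -> nat) : nat :=
  \sum_(s : m.-tuple letter | valid n s && P s) g (height s).

Let noM (s : seq letter) := lM \notin s.

Lemma height_step (s : seq letter) (g : nat -> nat) : valid n s ->
  (if count_mem lO s == count_mem lC s then g (height s) else 0) + g (height (lC :: s)) +
  (if count_mem lO s < count_mem lC s then g (height (lO :: s)) else 0) =
  g (height s).+1 + g (height s).-1.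
Proof.
move=> /valid_le le; rewrite /height /= add0n add1n subSn // add0n add1n subnS.
case: (ltngtP (count_mem lO s) (count_mem lC s)) => [lt|gt|->]; [by lia| |].
  by move: le; lia.
by rewrite subnn /=; lia.
Qed.

(** The letter read last is moved from the word into [dual]: [lC] goes up, and exactly one of [lO]
    (positive height) and [lF] (height 0) is allowed for the other move. *)
Lemma heights_step m q g (P : pred (seq letter)) :
    (forall x s, x != lM -> P (x :: s) = P s) ->
  heights m.+1 P (dual g q) = heights m P (dual g q.+1) +
    \sum_(s : m.-tuple letter | valid n (lM :: s) && P (lM :: s)) dual g q (height s).
Proof.
move=> PE; rewrite {1}/heights (sum_tuple_cons m (fun s => valid n s && P s)
  (fun s => dual g q (height s))) sum_letter -!addnA addnC; congr (_ + _).
pose V (s : m.-tuple letter) := valid n s && P s.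
have cond x (c : pred (seq letter)) (F : seq letter -> nat) : x != lM ->
    (forall s, allowed n x s = c s) ->
    \sum_(s : m.-tuple letter | valid n (x :: s) && P (x :: s)) F s =
    \sum_(s | V s) if c s then F s else 0.
  move=> xM ca; rewrite -big_mkcondr; apply: eq_bigl => s.
  by rewrite PE // [valid _ _]/= ca /V; case: (c s); case: (valid n s); case: (P s).
pose F x s := dual g q (height (x :: s)).
rewrite (cond lF (fun s => count_mem lO s == count_mem lC s) (F lF)) //.
rewrite (cond lC predT (F lC)) //.
rewrite (cond lO (fun s => count_mem lO s < count_mem lC s) (F lO)) //.
rewrite -!big_split /=; apply: eq_bigr => s /andP[vs _].
by rewrite addnA -(height_step (dual g q) vs).
Qed.

Lemma heights0 P g : heights 0 P g = if P [::] then g 0 else 0.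
Proof.
rewrite /heights (eq_bigl (fun s : 0.-tuple letter => P [::])); last first.
  by move=> s; rewrite tuple0.
case: (P [::]); last by rewrite big_pred0_eq.
by rewrite (big_pred1 [tuple]) // => s; apply/esym/eqP; exact: tuple0.
Qed.

Lemma heights_noM m q g : heights m noM (dual g q) = dual g (m + q) 0.
Proof.
elim: m q => [|m IH] q; first by rewrite heights0.
rewrite heights_step; last by move=> x s xM; rewrite /noM inE negb_or eq_sym xM.
rewrite big_pred0 ?addn0 ?IH ?addSnnS // => s.
by rewrite /noM inE eqxx andbF.
Qed.

Lemma heights_oneM m q : m + q = n ->
  heights m (predC noM) (dual (from_par 0) q) + 2 ^ q * tail_sum m n./2.+1 =
  m * tail n.-1 n./2.
Proof.
elim: m q => [|m IH] q mq; first by rewrite heights0 /=; lia.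
rewrite heights_step; last by move=> x s xM; rewrite /= /noM inE negb_or eq_sym xM.
have := IH q.+1; rewrite -addSnnS => /(_ mq) {}IH.
have all_noM : heights m noM (dual (from_par 0) q) = tail n.-1 n./2.
  by rewrite heights_noM; apply: etrans (dual_tail _); [congr dual; lia|lia].
(* With [q] letters left after [lM], the excluded heights exceed [q]; to end at an even height they
   must have the parity of [q], hence be at least q + 2. *)
have far : heights m noM (dual (from_par q.+2) 0) = tail m n./2.+1.
  by rewrite heights_noM addn0; apply: dual_tail; lia.
suff : \sum_(s : m.-tuple letter | valid n (lM :: s) && predC noM (lM :: s))
    dual (from_par 0) q (height s) + 2 ^ q * tail m n./2.+1 = tail n.-1 n./2.
  by move: IH; rewrite expnS /=; lia.
rewrite -all_noM -far /heights big_distrr /=.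
rewrite [RHS](bigID (fun s : m.-tuple letter => height s + m < n)) /=.
congr (_ + _).
  apply: eq_bigl => s; rewrite size_tuple andbT.
  case: (boolP (valid n s)) => [/valid_le le|_]; rewrite ?andbF ?andbT //=.
  congr (_ && _); rewrite /height; move: le.
  have K c o : o <= c -> (c + m < n + o) = (c - o + m < n) by lia.
  exact: K.
rewrite [LHS](bigID (fun s : m.-tuple letter => height s + m < n)) /= big1 ?add0n.
  apply: eq_bigr => s /andP[_ le]; rewrite dual_large; last by lia.
  by rewrite /from_par; congr (_ * _); lia.
by move=> s /andP[_ lt]; rewrite /from_par leqNgt; lia.
Qed.

Lemma num_valid_words :
  #|[set t : n.-tuple letter | valid n t && ~~ odd (height t)]| =
  tail n (uphalf n) + n./2.+1 * tail n n./2.+1.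
Proof.
have e1 : dual (from_par 0) n 0 = tail n (uphalf n).
  by apply: dual_tail; rewrite uphalf_half; have := odd_double_half n; lia.
have e2 := tail_sumE n n./2; have := heights_oneM (addn0 n).
rewrite expn0 mul1n => e3.
have H (P : pred (seq letter)) : \sum_(s : n.-tuple letter |
      (s \in [set t : n.-tuple letter | valid n t && ~~ odd (height t)]) && P s) 1 =
    heights n P (dual (from_par 0) 0).
  rewrite /heights [RHS](eq_bigr (fun s : n.-tuple letter =>
    if ~~ odd (height s) then 1 else 0)) => [|s _].
    by rewrite -big_mkcondr; apply: eq_bigl => s; rewrite inE andbAC.
  by rewrite /= /from_par /=; case: odd.
rewrite -sum1_card (bigID (fun s : n.-tuple letter => noM s)) /=.
rewrite (H noM).
rewrite (H (predC noM)) heights_noM addn0 e1; congr (_ + _).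
by move: e2 e3; lia.
Qed.

End CountWords.

Lemma num_single_tail n :
  num_single n = tail n (uphalf n) + n./2.+1 * tail n n./2.+1.
Proof. by rewrite num_single_words num_valid_words. Qed.

Import GRing.Theory Num.Theory.
Local Open Scope ring_scope.

Theorem corollary10p12 (n : nat) (hn : (1 <= n)%N) :
  num_single n = (num_single_neg n 0 + num_single_neg n 1)%N /\
  (odd n ->
     (num_single n)%:R = (n%:R + 3) * 2 ^ (n%:Z - 2) :> rat) /\
  (~~ odd n ->
     (num_single n)%:R =
       (n%:R + 4) * 2 ^ (n%:Z - 2) - n%:R / 4 * 'C(n, n./2)%:R :> rat).
Proof.
split; first exact: num_single_split.
have pow : 2 ^ (n%:Z - 2) = (2 ^ n)%N%:R / 4 :> rat.
  have e : 2 ^ (- 2 : int) = 4^-1 :> rat by [].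
  by rewrite expfzDr // e -exprnP natrX.
(* For odd [n] the symmetry gives twice the tail from (n+1)/2, which is therefore 2^(n-1); for even
   [n] the two tails differ by the central binomial coefficient. *)
have nE := odd_double_half n; have sym := @tail_sym n n./2.+1.
rewrite pow num_single_tail; split=> [no|ne].
  have e : uphalf n = n./2.+1 by rewrite uphalf_half no.
  rewrite no in nE; have /sym : (n./2.+1 <= n.+1)%N by lia.
  rewrite (_ : n.+1 - n./2.+1 = n./2.+1)%N; last by lia.
  rewrite e; move: (tail _ _) => T eT.
  have nR : n%:R = 1 + 2 * n./2%:R :> rat by rewrite -{1}nE natrD -mul2n natrM.
  rewrite -eT nR !(natrD, natrM) -natr1.
  by field.
have e : uphalf n = n./2 by rewrite uphalf_half (negPf ne).
rewrite (negPf ne) in nE; have /sym : (n./2.+1 <= n.+1)%N by lia.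
rewrite (_ : n.+1 - n./2.+1 = n./2)%N; last by lia.
have := tail_bin n n./2; rewrite e => eb.
rewrite eb; move: (tail _ _) ('C(_, _)) => T C eT.
have nR : n%:R = 2 * n./2%:R :> rat by rewrite -{1}nE add0n -mul2n natrM.
rewrite -eT nR !(natrD, natrM) -natr1.
by field.
Qed.
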